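(* Let $p\in(0,1)$, $(s,t)\in(0,\infty)^2$ and $\xi\in\mathbb R$. Then $$\lim_{N\to\infty}N^{-1}\log\mathbb E\, e^{\xi G_{\lfloor Ns\rfloor,\lfloor Nt\rfloor}}=I^*_{s,t}(\xi)=\begin{cases}J^*_{s,t}(\xi), & \text{if }\xi>0,\\ 0, & \text{if }\xi=0,\\ \xi\,g_{pp}(s,t), & \text{if }\xi<0.\end{cases}$$
   Context: Let $\{\omega_v\}_{v\in\mathbb Z_+^2}$ be i.i.d. Bernoulli($p$) random variables with values in $\{0,1\}$ and $\mathbb P\{\omega_v=1\}=p$, where $\mathbb Z_+=\{0,1,2,\dots\}$. An admissible path from $v$ to $w$ is a sequence $v=v_0,\dots,v_k=w$ in $\mathbb Z_+^2$ with $v_{i+1}-v_i\in\{e_1,e_2\}$. The last passage time is $G_{v,w}=\max_{\pi}\sum_{i}\omega_{v_{i+1}}\mathbf 1\{v_{i+1}-v_i=e_1\}$ (maximum over admissible paths from $v$ to $w$), and $G_{m,n}=G_{(0,0),(m,n)}$. Law of large numbers limit: $g_{pp}(s,t)=\big(\sqrt{ps}+\sqrt{(1-p)t}\big)^2-t$ if $t<s\frac{1-p}{p}$, and $g_{pp}(s,t)=s$ if $t\ge s\frac{1-p}{p}$. Right-tail rate function: $J_{s,t}(r)=-\lim_{N\to\infty}N^{-1}\log\mathbb P\{G_{\lfloor Ns\rfloor,\lfloor Nt\rfloor}\ge Nr\}$ for $r<s$ (the limit exists and is $0$ for $r\le g_{pp}(s,t)$, $r<s$), $J_{s,t}(s)=\lim_{r\nearrow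 s}J_{s,t}(r)$, and $J_{s,t}(r)=\infty$ for $r>s$. The full rate function is $I_{s,t}(r)=J_{s,t}(r)$ for $r\in[g_{pp}(s,t),s]$ and $I_{s,t}(r)=\infty$ otherwise. For $f:\mathbb R\to(-\infty,\infty]$, the Legendre dual is $f^*(\xi)=\sup_{r\in\mathbb R}\{\xi r-f(r)\}$. *)

(* Defs.v *)
From HB Require Import structures.
From mathcomp Require Export all_boot all_order all_algebra.
From mathcomp Require Export all_classical all_reals all_analysis.
Export Order.TTheory GRing.Theory Num.Theory.
Export numFieldNormedType.Exports.

Set Implicit Arguments.
Unset Strict Implicit.
Unset Printing Implicit Defensive.

Local Open Scope classical_set_scope.
Local Open Scope ring_scope.

Definition mutually_independent (d d' : measure_display)
    (T : measurableType d) (T' : measurableType d') (R : realType)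
    (P : probability T R) (I : eqType) (X : I -> {RV P >-> T'}) : Prop :=
  forall (s : seq I) (B : I -> set T'), uniq s ->
    (forall i, measurable (B i)) ->
    P (\big[setI/setT]_(i <- s) (X i @^-1` B i)) =
    (\prod_(i <- s) P (X i @^-1` B i))%E.

Definition iid_bernoulli (d : measure_display) (T : measurableType d)
    (R : realType) (P : probability T R) (p : R)
    (omega : nat * nat -> {RV P >-> bool}) : Prop :=
  mutually_independent omega /\
  forall v, P [set x | omega v x = true] = p%:E.

Definition e1_step (v w : nat * nat) : bool := w == (v.1.+1, v.2).
Definition e2_step (v w : nat * nat) : bool := w == (v.1, v.2.+1).

(* The path v = v_0, v_1, ..., v_k = w is represented by its starting point v
   together with the sequence [:: v_1; ...; v_k]. *)
Definition admissible (v w : nat * nat) (pi : seq (nat * nat)) : bool :=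
  path [rel x y | e1_step x y || e2_step x y] v pi && (last v pi == w).

(* [zip (v :: pi) pi] lists the steps (v_i, v_(i+1)). *)
Definition passage_time (eta : nat * nat -> bool) (v : nat * nat)
    (pi : seq (nat * nat)) : nat :=
  (\sum_(e <- zip (v :: pi) pi | e1_step e.1 e.2) eta e.2)%N.

(* The supremum is a maximum whenever there is an admissible path: see
   [last_passage_attained] and [last_passage_ub] below. *)
Definition last_passage (R : realType) (eta : nat * nat -> bool)
    (v w : nat * nat) : R :=
  sup [set (passage_time eta v pi)%:R | pi in [set pi | admissible v w pi]].

Lemma passage_time_le_size eta v pi : (passage_time eta v pi <= size pi)%N.
Proof.
rewrite /passage_time; elim: pi v => [|x pi IH] v; first by rewrite big_nil.
rewrite /= big_cons; case: ifP => _ /=; last exact: leqW.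
by rewrite -add1n leq_add ?IH//; case: (eta x).
Qed.

Lemma admissible_size v w pi : admissible v w pi ->
  (size pi = (w.1 + w.2) - (v.1 + v.2))%N /\ (v.1 + v.2 <= w.1 + w.2)%N.
Proof.
have : admissible v w pi -> (w.1 + w.2 = v.1 + v.2 + size pi)%N.
  elim: pi v => [|x pi IH] v.
    by rewrite /admissible /= => /eqP ->; rewrite addn0.
  rewrite /admissible /= => /andP[/andP[vx xpi] lst].
  rewrite (IH x) /admissible ?xpi//=.
  by case/orP: vx => /eqP -> /=; rewrite ?addSn ?addnS ?addSn.
by move=> H /H ->; rewrite addKn leq_addr.
Qed.

Section last_passage_max.
Variables (R : realType) (eta : nat * nat -> bool) (v w : nat * nat).

Lemma last_passage_has_ub : has_ubound
  [set ((passage_time eta v pi)%:R : R) | pi in [set pi | admissible v w pi]].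
Proof.
exists ((w.1 + w.2) - (v.1 + v.2))%:R => _ [pi /= /admissible_size[<- _] <-].
by rewrite ler_nat passage_time_le_size.
Qed.

Lemma last_passage_ub pi : admissible v w pi ->
  (passage_time eta v pi)%:R <= last_passage R eta v w.
Proof. by move=> api; apply: ub_le_sup last_passage_has_ub _ _; exists pi. Qed.

Lemma last_passage_attained : (exists pi, admissible v w pi) ->
  exists2 pi, admissible v w pi &
    last_passage R eta v w = (passage_time eta v pi)%:R.
Proof.
move=> [pi0 api0].
pose Q k := `[< exists2 pi, admissible v w pi & passage_time eta v pi = k >].
have exQ : exists k, Q k.
  by exists (passage_time eta v pi0); apply/asboolP; exists pi0.
have ubQ k : Q k -> (k <= (w.1 + w.2) - (v.1 + v.2))%N.
  by move=> /asboolP[pi /admissible_size[<- _] <-]; exact: passage_time_le_size.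
case: (ex_maxnP exQ ubQ) => k /asboolP[pi api <-] kmax.
exists pi => //; apply/eqP; rewrite eq_le last_passage_ub// andbT.
apply: ge_sup; first by exists (passage_time eta v pi0)%:R, pi0.
move=> _ [pi' /= api' <-]; rewrite ler_nat.
by apply: kmax; apply/asboolP; exists pi'.
Qed.

End last_passage_max.

Lemma admissible_from_origin m n : exists pi, admissible (0, 0)%N (m, n) pi.
Proof.
elim: m => [|m [pi /andP[ppi lpi]]].
  elim: n => [|n [pi /andP[ppi lpi]]]; first by exists [::].
  exists (rcons pi (0, n.+1)%N).
  by rewrite /admissible rcons_path ppi last_rcons (eqP lpi) /= /e1_step /e2_step /= !eqxx ?orbT.
exists (rcons pi (m.+1, n)).
by rewrite /admissible rcons_path ppi last_rcons (eqP lpi) /= /e1_step !eqxx.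
Qed.

Definition gpp (R : realType) (p s t : R) : R :=
  if t < s * ((1 - p) / p)
  then (Num.sqrt (p * s) + Num.sqrt ((1 - p) * t)) ^+ 2 - t
  else s.

Section rate_functions.
Context (d : measure_display) (T : measurableType d) (R : realType)
  (P : probability T R).
Variable omega : nat * nat -> {RV P >-> bool}.

Definition G (m n : nat) (x : T) : R :=
  last_passage R (fun v => omega v x) (0, 0)%N (m, n).

(* [Num.truncn] is the natural-number valued floor of a nonnegative real. *)
Definition Gfloor (s t : R) (N : nat) (x : T) : R :=
  G (Num.truncn (N%:R * s)) (Num.truncn (N%:R * t)) x.

(* [lne 0 = -oo]; for r < s the probability is positive for all large N. *)
Definition J_below (s t r : R) : \bar R :=
  (- lim ((N%:R^-1)%:E * lne (P [set x | (N%:R * r <= Gfloor s t N x)%R])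
          @[N --> \oo]))%E.

Definition rate_J (s t r : R) : \bar R :=
  if r < s then J_below s t r
  else if r == s then lim (J_below s t r' @[r' --> s^'-])
  else +oo%E.

Definition rate_I (p s t r : R) : \bar R :=
  if gpp p s t <= r <= s then rate_J s t r else +oo%E.

End rate_functions.

Definition legendre (R : realType) (f : R -> \bar R) (xi : R) : \bar R :=
  ereal_sup (range (fun r : R => (xi * r)%:E - f r)%E).

(* Main.v *)
From mathcomp Require Import ring lra zify measurable_realfun.
Require Import Defs.

(** The passage time satisfies the recursion of [lpp], and each column contributes
independently, at most one unit ([mgf_iid], [Elpp_mgf]). The proof has three
parts.

The mean of [G] at [(N s, N t)] is [N * gpp p s t] up to [o(N)] ([mean_at_le],
[mean_at_ge]). Adding a bottom row of Bernoulli(u) increments with [u > p], and a left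
column of geometric ones, turns the increments of [G] into a series of queues
in equilibrium: Burke's theorem ([burke_row], [burke_total]) says that the queue
lengths on the right are again independent and geometric, of mean [vmean p u]. As
boundaries only help, [G] has mean at most [s * u + t * vmean p u] per unit
([mean_upper]), and the minimum over [u] is [gpp] ([gpp_characteristic]). For
the lower bound, the explicit transform of the boundary model is at most the sum
over all points where a path can leave the boundary ([mean_lower_sum]). At the
critical density [u], all exits away from the origin are exponentially too
small by the upper bound at nearby densities ([exit_bound]), so the term at the origin,
which is [G] itself, must be as large as claimed ([mean_lower]). Buffers of
finite capacity keep all sums finite.

For [xi < 0], Jensen's inequality gives the lower bound. For the upper bound, the
path may choose among [K] disjoint parallel corridors since vertical steps are
free; the best corridor is at least their average, whose exponential moment has a
Gaussian correction divided by [K] ([corridor_mgf]).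

For the right tail, [P (G >= N r)] is supermultiplicative in [N] without error
([tail_super]), so the rate exists by Fekete's lemma. It vanishes below [g = gpp p s t]
by the law of large numbers, and at [g] by concatenating a long cheap stretch
with a short expensive one ([Jr_below], [Jr_gpp]). Hence both [I^*] and
[J^*] are given by slopes in [[g, s]], and for [xi > 0] the limit follows by
cutting that range into small pieces ([mgf_pos_le_pieces]). *)

Set Implicit Arguments.
Unset Strict Implicit.
Unset Printing Implicit Defensive.

Local Open Scope ring_scope.

(** * Finite distributions *)

Section FiniteDistributions.
Context {R : realType}.

(** Laws with finite support are lists of (weight, value) pairs instead of
measures: means are then finite sums and exchanging two of them is
[exchange_big]. *)
Definition fmean (A : eqType) (d : seq (R * A)) (f : A -> R) : R :=
  \sum_(e <- d) e.1 * f e.2.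

Definition supp (A : eqType) (d : seq (R * A)) : seq A := [seq e.2 | e <- d].

Definition isdist (A : eqType) (d : seq (R * A)) : Prop :=
  all (fun e => 0 <= e.1) d /\ \sum_(e <- d) e.1 = 1.

Section OneLaw.
Variables (A : eqType) (d : seq (R * A)).

Lemma eq_fmean f g : {in supp d, f =1 g} -> fmean d f = fmean d g.
Proof.
move=> fg; rewrite /fmean big_seq [RHS]big_seq; apply: eq_bigr => e ed.
by rewrite fg// map_f.
Qed.

Lemma fmeanD f g : fmean d (fun a => f a + g a) = fmean d f + fmean d g.
Proof. by rewrite /fmean -big_split; apply: eq_bigr => e _; rewrite /= mulrDr. Qed.

Lemma fmeanZ f c : fmean d (fun a => c * f a) = c * fmean d f.
Proof. by rewrite /fmean mulr_sumr; apply: eq_bigr => e _; rewrite mulrCA. Qed.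

Lemma fmeanZr f c : fmean d (fun a => f a * c) = fmean d f * c.
Proof. by rewrite mulrC -fmeanZ; apply: eq_fmean => a _; rewrite mulrC. Qed.

Lemma fmean_sum (I : Type) (r : seq I) (F : I -> A -> R) :
  fmean d (fun a => \sum_(i <- r) F i a) = \sum_(i <- r) fmean d (F i).
Proof. by rewrite /fmean exchange_big; apply: eq_bigr => e _; rewrite mulr_sumr. Qed.

Hypothesis dd : isdist d.

Lemma fmean_cst c : fmean d (fun=> c) = c.
Proof. by rewrite /fmean -mulr_suml dd.2 mul1r. Qed.

Lemma ler_fmean f g : {in supp d, forall a, f a <= g a} -> fmean d f <= fmean d g.
Proof.
move=> fg; rewrite /fmean big_seq [leRHS]big_seq; apply: ler_sum => e ed.
by rewrite ler_wpM2l ?fg ?map_f// (allP dd.1).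
Qed.

Lemma fmean_ge0 f : (forall a, 0 <= f a) -> 0 <= fmean d f.
Proof. by move=> f0; rewrite -(fmean_cst 0); apply: ler_fmean. Qed.

(** Jensen's inequality for the exponential, from its tangent line at the mean. *)
Lemma jensen_expR th f : expR (th * fmean d f) <= fmean d (fun a => expR (th * f a)).
Proof.
set mu := fmean d f.
have -> : expR (th * mu) =
    fmean d (fun a => expR (th * mu) * (1 + th * f a - th * mu)).
  by rewrite fmeanZ !fmeanD !fmean_cst fmeanZ -/mu addrK mulr1.
apply: ler_fmean => a _.
have -> : expR (th * f a) = expR (th * mu) * expR (th * f a - th * mu).
  by rewrite -expRD addrC subrK.
by rewrite ler_pM2l ?expR_gt0// -addrA expR_ge1Dx.
Qed.

Lemma expR_quadratic (x : R) : x <= 2^-1 -> expR x <= 1 + x + 2 * x ^+ 2.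
Proof.
move=> x12; have h := expR_ge1Dx (- x); rewrite expRN in h.
have h2 : expR x * (1 - x) <= 1.
  have := ler_wpM2l (ltW (expR_gt0 x)) h.
  by rewrite mulfV// gt_eqF// expR_gt0.
have x1 : 0 < 1 - x by lra.
rewrite -(ler_pM2r x1); apply: le_trans h2 _; nra.
Qed.

(** A variable of oscillation at most [1] is sub-Gaussian: its deviation from the
mean is at most [1], and the first-order term of the exponential averages out. *)
Lemma mgf_le th f : `|th| <= 2^-1 ->
  {in supp d &, forall a b, `|f a - f b| <= 1} ->
  fmean d (fun a => expR (th * f a)) <= expR (th * fmean d f + 2 * th ^+ 2).
Proof.
move=> th2 fosc; set mu := fmean d f.
have fmu a : a \in supp d -> `|f a - mu| <= 1.
  move=> ad; have fa b : b \in supp d -> f a - 1 <= f b <= f a + 1.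
    by move=> bd; have := fosc _ _ ad bd; rewrite ler_norml; lra.
  have h1 : f a - 1 <= mu.
    by rewrite -(fmean_cst (f a - 1)); apply: ler_fmean => b /fa /andP[].
  have h2 : mu <= f a + 1.
    by rewrite -(fmean_cst (f a + 1)); apply: ler_fmean => b /fa /andP[].
  by rewrite ler_norml; lra.
apply: (@le_trans _ _ (fmean d (fun a => expR (th * mu) *
    (1 + 2 * th ^+ 2 - th * mu + th * f a)))).
  apply: ler_fmean => a ad.
  have -> : expR (th * f a) = expR (th * mu) * expR (th * (f a - mu)).
    by rewrite -expRD; congr expR; ring.
  rewrite ler_pM2l ?expR_gt0//.
  have := fmu _ ad; set z := f a - mu => z1.
  have thz : `|th * z| <= 2^-1.
    by rewrite normrM -[leRHS]mulr1 ler_pM.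
  have := @expR_quadratic (th * z); move: (thz); rewrite ler_norml => /andP[_ h].
  move=> /(_ h) /le_trans; apply.
  have -> : th * z = th * f a - th * mu by rewrite /z; ring.
  have : (th * z) ^+ 2 <= th ^+ 2.
    by rewrite exprMn ler_piMr ?sqr_ge0// -real_normK ?num_real// expr_le1.
  by have -> : th * z = th * f a - th * mu; [rewrite /z; ring | lra].
rewrite fmeanZ fmeanD fmean_cst fmeanZ -/mu subrK expRD ler_pM2l ?expR_gt0//.
exact: expR_ge1Dx.
Qed.

End OneLaw.

Lemma fmean_exchange (A B : eqType) (d : seq (R * A)) (d' : seq (R * B)) f :
  fmean d (fun a => fmean d' (f a)) = fmean d' (fun b => fmean d (f ^~ b)).
Proof.
rewrite /fmean; under eq_bigr do rewrite mulr_sumr.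
rewrite exchange_big; apply: eq_bigr => e _; rewrite mulr_sumr.
by apply: eq_bigr => e' _; rewrite mulrCA.
Qed.

Fixpoint iid_law (A : eqType) (d : seq (R * A)) (n : nat) : seq (R * seq A) :=
  if n is n'.+1 then [seq (x.1 * y.1, x.2 :: y.2) | x <- d, y <- iid_law d n']
  else [:: (1, [::])].

Section IndependentSamples.
Variables (A : eqType) (d : seq (R * A)).

Lemma fmean_iid0 f : fmean (iid_law d 0) f = f [::].
Proof. by rewrite /fmean big_seq1 mul1r. Qed.

Lemma fmean_iidS n f :
  fmean (iid_law d n.+1) f = fmean d (fun a => fmean (iid_law d n) (fun l => f (a :: l))).
Proof.
rewrite /fmean big_allpairs_dep; apply: eq_bigr => e _; rewrite mulr_sumr.
by apply: eq_bigr => e' _; rewrite mulrA.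
Qed.

Lemma isdist_iid n : isdist d -> isdist (iid_law d n).
Proof.
move=> [d0 d1]; elim: n => [|n [IH0 IH1]]; first by split; rewrite /= ?ler01 ?big_seq1.
split.
  apply/allP => _ /allpairsP[[x y] /= [xd yd ->]] /=.
  by rewrite mulr_ge0 ?(allP d0)// (allP IH0).
rewrite big_allpairs_dep -[RHS]d1; apply: eq_bigr => e _ /=.
by rewrite -mulr_sumr IH1 mulr1.
Qed.

Lemma iid_lawP n l : l \in supp (iid_law d n) ->
  size l = n /\ {subset l <= supp d}.
Proof.
elim: n l => [|n IH] l /=; first by rewrite inE => /eqP ->.
move=> /mapP[_ /allpairsP[[x y] /= [xd yd ->]] ->] /=.
have [-> sub] := IH _ (map_f _ yd); split=> // a; rewrite inE => /orP[/eqP ->|].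
  exact: map_f.
exact: sub.
Qed.

Lemma fmean_iid_cat n1 n2 f : fmean (iid_law d (n1 + n2)) f =
  fmean (iid_law d n1) (fun l1 => fmean (iid_law d n2) (fun l2 => f (l1 ++ l2))).
Proof.
elim: n1 f => [|n1 IH] f; first by rewrite fmean_iid0.
by rewrite addSn !fmean_iidS; apply: eq_fmean => a _; rewrite IH.
Qed.

Lemma fmean_iid_prod n f :
  fmean (iid_law d n) (fun l => \prod_(a <- l) f a) = fmean d f ^+ n.
Proof.
elim: n => [|n IH]; first by rewrite fmean_iid0 big_nil.
rewrite fmean_iidS exprS -IH -fmeanZr; apply: eq_fmean => a _.
by rewrite -fmeanZ; apply: eq_fmean => l _; rewrite big_cons.
Qed.

(** Bounded differences (McDiarmid): when the samples are averaged one at a time,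
each contributes one sub-Gaussian factor, because averaging over the remaining
samples preserves the oscillation bound. *)
Lemma mgf_iid th n F : isdist d -> `|th| <= 2^-1 ->
  (forall l1 a b l2, (size l1 + size l2).+1 = n ->
     `|F (l1 ++ a :: l2) - F (l1 ++ b :: l2)| <= 1) ->
  fmean (iid_law d n) (fun l => expR (th * F l)) <=
  expR (th * fmean (iid_law d n) F + 2 * n%:R * th ^+ 2).
Proof.
move=> dd th2; elim: n F => [|n IH] F Fb.
  by rewrite !fmean_iid0 mulr0 mul0r addr0.
rewrite !fmean_iidS.
have ddn := isdist_iid n dd.
apply: (@le_trans _ _ (fmean d (fun a =>
   expR (th * fmean (iid_law d n) (fun l => F (a :: l))) *
     expR (2 * n%:R * th ^+ 2)))).
  apply: ler_fmean => // a _; rewrite -expRD; apply: IH => l1 b c l2 sz.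
  by apply: (Fb (a :: l1)); rewrite /= -sz.
rewrite fmeanZr; apply: (le_trans (ler_wpM2r (expR_ge0 _) (mgf_le dd th2 _))).
  move=> a b _ _; apply/ler_normlP; split.
    rewrite opprB lerBlDr -{1}(fmean_cst ddn 1) -fmeanD; apply: ler_fmean => // l /iid_lawP[sl _].
    by have := Fb [::] b a l; rewrite /= sl => /(_ erefl)/ler_normlP[_]; lra.
  rewrite lerBlDr -{1}(fmean_cst ddn 1) -fmeanD; apply: ler_fmean => // l /iid_lawP[sl _].
  by have := Fb [::] a b l; rewrite /= sl => /(_ erefl)/ler_normlP[_]; lra.
rewrite -expRD ler_expR -natr1; lra.
Qed.

End IndependentSamples.

Lemma fmean_iid_flatten (A : eqType) (d : seq (R * A)) m n f :
  fmean (iid_law d (m * n)) f = fmean (iid_law (iid_law d n) m) (fun ll => f (flatten ll)).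
Proof.
elim: m f => [|m IH] f; first by rewrite !fmean_iid0.
rewrite mulSn fmean_iid_cat fmean_iidS; apply: eq_fmean => l _.
by rewrite IH.
Qed.

Definition bernoulli_law (p : R) : seq (R * bool) := [:: (p, true); (1 - p, false)].

Lemma fmean_bernoulli p f : fmean (bernoulli_law p) f = p * f true + (1 - p) * f false.
Proof. by rewrite /fmean big_cons big_seq1. Qed.

Lemma isdist_bernoulli p : 0 <= p <= 1 -> isdist (bernoulli_law p).
Proof.
move=> /andP[p0 p1]; split; first by rewrite /= p0 subr_ge0 p1.
by rewrite big_cons big_seq1 /=; ring.
Qed.

End FiniteDistributions.

(** * The last passage recursion *)

(** Dynamic programming for the last passage time from the origin to [(m, n)],
splitting paths according to their last step. *)
Fixpoint lpp (eta : nat * nat -> bool) (m : nat) : nat -> nat :=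
  if m is m'.+1 then
    fix lpp_col n :=
      if n is n'.+1 then maxn (lpp eta m' n + eta (m, n)) (lpp_col n')
      else lpp eta m' 0 + eta (m, 0)
  else fun=> 0%N.

Lemma lpp0n eta n : lpp eta 0 n = 0%N. Proof. by []. Qed.

Lemma lppS0 eta m : lpp eta m.+1 0 = (lpp eta m 0 + eta (m.+1, 0))%N.
Proof. by []. Qed.

Lemma lppSS eta m n : lpp eta m.+1 n.+1 =
  maxn (lpp eta m n.+1 + eta (m.+1, n.+1)) (lpp eta m.+1 n).
Proof. by []. Qed.

Lemma passage_time_rcons eta v pi x : passage_time eta v (rcons pi x) =
  (passage_time eta v pi + (e1_step (last v pi) x && eta x))%N.
Proof.
rewrite /passage_time.
have -> : zip (v :: rcons pi x) (rcons pi x) =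
    rcons (zip (v :: pi) pi) (last v pi, x).
  by elim: pi v => //= y pi IH v; rewrite IH.
rewrite -cats1 big_cat big_cons big_nil; congr (_ + _)%N.
by rewrite /=; case: (e1_step _ _); rewrite ?addn0.
Qed.

Lemma lpp_step1 eta m n : (lpp eta m n + eta (m.+1, n) <= lpp eta m.+1 n)%N.
Proof. by case: n => [|n]; rewrite ?lppS0// lppSS leq_maxl. Qed.

Lemma lpp_step2 eta m n : (lpp eta m n <= lpp eta m n.+1)%N.
Proof. by case: m => [|m]//; rewrite lppSS leq_maxr. Qed.

Lemma lpp_path_ub eta pi :
  path [rel x y | e1_step x y || e2_step x y] (0, 0)%N pi ->
  (passage_time eta (0, 0)%N pi <=
   lpp eta (last (0, 0)%N pi).1 (last (0, 0)%N pi).2)%N.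
Proof.
elim/last_ind: pi => [|pi x IH]; first by rewrite /passage_time big_nil.
rewrite rcons_path => /andP[/IH {}IH st].
rewrite passage_time_rcons last_rcons.
move: IH st; case: (last _ _) => m n /= IH.
rewrite /e1_step /e2_step; case: x => a b; rewrite !xpair_eqE /=.
case: (boolP ((a == m.+1) && (b == n))) => [/andP[/eqP -> /eqP ->] _ | _ /= ].
  by apply: leq_trans (lpp_step1 _ _ _); rewrite leq_add2r.
by move=> /andP[/eqP -> /eqP ->]; rewrite addn0 (leq_trans IH)// lpp_step2.
Qed.

Lemma lpp_path_attained eta m n :
  exists2 pi, admissible (0, 0)%N (m, n) pi &
    passage_time eta (0, 0)%N pi = lpp eta m n.
Proof.
elim: m n => [|m IHm] n.
  elim: n => [|n [pi /andP[ppi /eqP lpi] e]].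
    by exists [::]; rewrite // /passage_time big_nil.
  exists (rcons pi (0, n.+1)%N).
    by rewrite /admissible rcons_path ppi last_rcons lpi /= /e1_step /e2_step /= !eqxx ?orbT.
  by rewrite passage_time_rcons e lpi /e1_step.
elim: n => [|n [pi /andP[ppi /eqP lpi] e]].
  have [pi /andP[ppi /eqP lpi] e] := IHm 0%N.
  exists (rcons pi (m.+1, 0)%N).
    by rewrite /admissible rcons_path ppi last_rcons lpi /= /e1_step /e2_step /= !eqxx ?orbT.
  by rewrite passage_time_rcons e lpi /e1_step eqxx lppS0.
rewrite lppSS; case: leqP => h.
  exists (rcons pi (m.+1, n.+1)%N).
    by rewrite /admissible rcons_path ppi last_rcons lpi /= /e1_step /e2_step /= !eqxx ?orbT.
  rewrite passage_time_rcons e lpi /e1_step /= xpair_eqE.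
  by rewrite (gtn_eqF (ltnSn _)) andbF addn0.
have [pi' /andP[ppi' /eqP lpi'] e'] := IHm n.+1.
exists (rcons pi' (m.+1, n.+1)%N).
  by rewrite /admissible rcons_path ppi' last_rcons lpi' /= /e1_step /e2_step /= !eqxx ?orbT.
by rewrite passage_time_rcons e' lpi' /e1_step eqxx.
Qed.

Lemma last_passageE (R : realType) eta m n :
  last_passage R eta (0, 0)%N (m, n) = (lpp eta m n)%:R.
Proof.
apply/eqP; rewrite eq_le; apply/andP; split.
  have [pi /andP[ppi /eqP lpi] ->] :=
    last_passage_attained R eta (admissible_from_origin m n).
  by rewrite ler_nat; have := lpp_path_ub eta ppi; rewrite lpi.
have [pi api <-] := lpp_path_attained eta m n.
exact: last_passage_ub.
Qed.

Lemma lpp_le_step1 eta m n : (lpp eta m n <= lpp eta m.+1 n)%N.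
Proof. exact: leq_trans (leq_addr _ _) (lpp_step1 _ _ _). Qed.

Lemma lpp_mono eta m n m' n' : (m <= m')%N -> (n <= n')%N ->
  (lpp eta m n <= lpp eta m' n')%N.
Proof.
move=> mm' nn'; apply: (@leq_trans (lpp eta m' n)).
  rewrite -(subnKC mm'); elim: (m' - m)%N => [|k IH]; first by rewrite addn0.
  by rewrite addnS (leq_trans IH)// lpp_le_step1.
rewrite -(subnKC nn'); elim: (n' - n)%N => [|k IH]; first by rewrite addn0.
by rewrite addnS (leq_trans IH)// lpp_step2.
Qed.

Lemma lpp_lip eta m n : (lpp eta m.+1 n <= (lpp eta m n).+1)%N.
Proof.
elim: n => [|n IH].
  by rewrite lppS0; case: (eta _); lia.
rewrite lppSS geq_max; apply/andP; split; first by case: (eta _); lia.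
by rewrite (leq_trans IH)// ltnS lpp_step2.
Qed.

Lemma lpp_le eta m n : (lpp eta m n <= m)%N.
Proof. by elim: m => [|m IH]//; rewrite (leq_trans (lpp_lip _ _ _)). Qed.

Definition shift (v : nat * nat) (eta : nat * nat -> bool) : nat * nat -> bool :=
  fun w => eta (v.1 + w.1, v.2 + w.2)%N.

(** Concatenation of an optimal path to [(m1, n1)] with one that starts there. *)
Lemma lpp_superadditive eta m1 n1 m2 n2 :
  (lpp eta m1 n1 + lpp (shift (m1, n1) eta) m2 n2 <=
   lpp eta (m1 + m2) (n1 + n2))%N.
Proof.
elim: m2 n2 => [|m2 IHm] n2; first by rewrite lpp0n !addn0 lpp_mono// leq_addr.
elim: n2 => [|n2 IHn].
  have := IHm 0%N; rewrite lppS0 !addnS /shift /= addnS addnA => h.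
  by apply: leq_trans (lpp_step1 _ _ _); rewrite leq_add2r.
rewrite lppSS addn_maxr geq_max; apply/andP; split.
  rewrite addnA addnS {2}/shift /= addnS.
  by apply: leq_trans (lpp_step1 _ _ _); rewrite leq_add2r IHm.
by rewrite (leq_trans IHn)// lpp_mono// leq_add2l.
Qed.

(** Only the weights of the columns [1..m] and the rows [0..n] matter: column [0]
is never entered by a horizontal step. *)
Lemma eq_lpp eta eta' m n :
  (forall i j, (1 <= i <= m)%N -> (j <= n)%N -> eta (i, j) = eta' (i, j)) ->
  lpp eta m n = lpp eta' m n.
Proof.
elim: m n => [|m IHm] n // e.
have eq_m k : (k <= n)%N -> lpp eta m k = lpp eta' m k.
  move=> kn; apply: IHm => i j /andP[i1 im] jk.
  by rewrite e ?i1 ?(leqW im)// (leq_trans jk).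
elim: n e eq_m => [|n IHn] e eq_m; first by rewrite !lppS0 eq_m// e// leqnn.
rewrite !lppSS eq_m// e ?leqnn// IHn// => [i j im jn|k kn].
  by rewrite e// (leq_trans jn).
by rewrite eq_m// (leq_trans kn).
Qed.

(** A path takes exactly one weighted step into each column, so resampling a
column moves the passage time by at most one. *)
Lemma lpp_column_change eta eta' m n (c : nat) :
  (forall i j : nat, (0 < i)%N -> i != c -> eta (i, j) = eta' (i, j)) ->
  (lpp eta m n <= lpp eta' m n + 1)%N.
Proof.
move=> e; suff h : (lpp eta m n <= lpp eta' m n + (c <= m))%N.
  by rewrite (leq_trans h)// leq_add2l leq_b1.
elim: m n => [|m IHm] n //.
have [|mc] := eqVneq c m.+1.
  move=> mc; have {}IHm k : (lpp eta m k <= lpp eta' m k)%N.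
    by apply: leq_trans (IHm k) _; rewrite mc ltnn addn0.
  rewrite mc leqnn; elim: n => [|n IHn].
    by rewrite !lppS0; have := IHm 0%N; case: (eta _); case: (eta' _); lia.
  rewrite !lppSS; move: (IHm n.+1) IHn.
  move: (lpp eta m n.+1) (lpp eta' m n.+1) (lpp eta m.+1 n) (lpp eta' m.+1 n).
  by case: (eta (_, n.+1)); case: (eta' (_, n.+1)) => /= *; lia.
have -> : (c <= m.+1)%N = (c <= m)%N by lia.
elim: n => [|n IHn].
  rewrite !lppS0 e 1?eq_sym//; move: (IHm 0%N).
  by move: (lpp eta m 0) (lpp eta' m 0) (c <= m)%N (eta' _) => ? ? [] [] /= *; lia.
rewrite !lppSS e 1?eq_sym//; move: (IHm n.+1) IHn.
move: (lpp eta m n.+1) (lpp eta' m n.+1) (lpp eta m.+1 n) (lpp eta' m.+1 n).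
by move: (c <= m)%N (eta' _) => [] [] /= *; lia.
Qed.

(** * From the probability space to finite sums *)

(** [iid_law (bernoulli_law p) n] lists each word of length [n] exactly once, with
its probability ([iid_enum], [iid_weight]). *)
Lemma iid_weight {R : realType} (p : R) n e : e \in iid_law (bernoulli_law p) n ->
  e.1 = \prod_(b <- e.2) (if b then p else 1 - p).
Proof.
elim: n e => [|n IH] e; first by rewrite inE => /eqP ->; rewrite big_nil.
move=> /allpairsP[[x y] /= [xd yd ->]] /=; rewrite big_cons (IH _ yd); congr (_ * _).
by move: xd; rewrite !inE => /orP[] /eqP ->.
Qed.

Lemma iid_enum {R : realType} (p : R) (f : seq bool -> R) n l : size l = n ->
  \sum_(e <- iid_law (bernoulli_law p) n) f e.2 * (e.2 == l)%:R = f l.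
Proof.
elim: n f l => [|n IH] f [|b l]//= sl; first by rewrite big_seq1 mulr1.
rewrite cats0 big_cat !big_map /=.
have sE c : \sum_(j <- iid_law (bernoulli_law p) n)
    f (c :: j.2) * ((c :: j.2) == (b :: l))%:R = (c == b)%:R * f (c :: l).
  case: sl => sl; rewrite -(IH (fun l' => f (c :: l')) l sl) mulr_sumr.
  by apply: eq_bigr => e _; rewrite eqseq_cons -mulnb natrM; ring.
by rewrite !sE; case: b {sl sE}; rewrite !eqxx /=; ring.
Qed.

Section Link.
Local Open Scope classical_set_scope.
Context (d : measure_display) (T : measurableType d) (R : realType)
  (P : probability T R) (p : R) (omega : nat * nat -> {RV P >-> bool}).
Hypothesis omega_iid : iid_bernoulli p omega.

Definition env (x : T) : nat * nat -> bool := fun v => omega v x.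

Let cyl (s : seq (nat * nat)) (l : seq bool) : set T :=
  \big[setI/setT]_(v <- s) (omega v @^-1` [set nth false l (index v s)]).

Let cylP s l x : uniq s -> size l = size s ->
  cyl s l x <-> map (env x) s = l.
Proof.
move=> us sl; rewrite /cyl.
have bigP g : (\big[setI/setT]_(v <- s) (omega v @^-1` [set g v])) x <->
    (forall v, v \in s -> omega v x = g v).
  elim: s {us sl} => [|w s IH]; first by rewrite big_nil; split.
  rewrite big_cons; split=> [[/= h1 /IH h2] v|h].
    by rewrite inE => /orP[/eqP -> //|/h2].
  by split; [apply: h; rewrite inE eqxx | apply/IH => v vs; apply: h; rewrite inE vs orbT].
apply: (iff_trans (bigP _)).
split=> [h|<- v vs].
  apply: (@eq_from_nth _ false); rewrite ?size_map// => i si.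
  by rewrite (nth_map (0, 0)%N)// /env h ?mem_nth// index_uniq.
by rewrite (nth_map (0, 0)%N) ?index_mem// nth_index.
Qed.

Let measurable_omega v (B : set bool) : measurable (omega v @^-1` B).
Proof. exact: measurable_funPTI. Qed.

Let measurable_cyl s l : measurable (cyl s l).
Proof. by apply: bigsetI_measurable => v _; exact: measurable_omega. Qed.

Let P_omega v b : P (omega v @^-1` [set b]) = (if b then p else 1 - p)%:E.
Proof.
case: omega_iid => _ /(_ v) h; case: b => //.
have -> : omega v @^-1` [set false] = ~` (omega v @^-1` [set true]).
  by apply/seteqP; split => x /=; case: (omega v x).
by rewrite probability_setC ?h// -EFinB.
Qed.

Let P_cyl s l : uniq s -> size l = size s ->
  P (cyl s l) = (\prod_(b <- l) (if b then p else 1 - p))%:E.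
Proof.
move=> us sl; case: omega_iid => /(_ s (fun v => [set nth false l (index v s)]) us) h _.
rewrite /cyl h//.
rewrite (eq_bigr (fun v => (if nth false l (index v s) then p else 1 - p)%:E));
  last by move=> v _; exact: P_omega.
rewrite prodEFin; congr EFin.
rewrite (big_nth false) big_mkord (big_nth (0, 0)%N) big_mkord sl.
by apply: eq_bigr => i _; rewrite index_uniq.
Qed.

(** The probability space is used only through this lemma and the next one: a
function of finitely many weights is a sum over cylinder events, whose
probabilities factor by independence. *)
Lemma expect_finite s f : uniq s -> (forall l, 0 <= f l) ->
  'E_P[fun x => f (map (env x) s)]%E = (fmean (iid_law (bernoulli_law p) (size s)) f)%:E.
Proof.
move=> us f0; rewrite unlock.
under eq_integral => x _.
  rewrite -(@iid_enum _ p f (size s)) ?size_map// -sumEFin big_seq.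
  under eq_bigr => e ed.
    have [se _] := iid_lawP (map_f snd ed).
    have -> : (e.2 == map (env x) s)%:R = \1_(cyl s e.2) x :> R.
      rewrite indicE; congr (nat_of_bool _)%:R; apply/eqP/idP => [h|].
        by rewrite inE; apply/cylP.
      by rewrite inE => /cylP ->.
    over.
  rewrite -big_seq; over.
rewrite ge0_integral_sum//=; last 2 first.
- move=> e; apply/measurable_EFinP; exact: measurable_funM.
- by move=> e x _; rewrite lee_fin mulr_ge0.
rewrite /fmean -sumEFin big_seq [RHS]big_seq; apply: eq_bigr => e ed.
have [se _] := iid_lawP (map_f snd ed).
under eq_integral do rewrite EFinM.
rewrite ge0_integralZl//; last 2 first.
- by apply/measurable_EFinP; exact: measurable_indic.
- by rewrite lee_fin.
rewrite integral_indic// setIT (iid_weight ed) mulrC EFinM.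
by congr (_ * _)%E; exact: P_cyl.
Qed.

Lemma prob_finite s (Q : pred (seq bool)) : uniq s ->
  P [set x | Q (map (env x) s)] =
  (fmean (iid_law (bernoulli_law p) (size s)) (fun l => (Q l)%:R))%:E.
Proof.
move=> us; rewrite -expect_finite// unlock.
have mQ : measurable [set x | Q (map (env x) s)].
  have -> : [set x | Q (map (env x) s)] =
      \bigcup_(l in [set l | l \in supp (iid_law (bernoulli_law p) (size s)) /\ Q l]) cyl s l.
    apply/seteqP; split=> x /=.
      move=> Qx; exists (map (env x) s); last by apply/cylP; rewrite ?size_map.
      split=> //; have := @iid_enum _ p (fun=> 1) (size s) (map (env x) s).
      rewrite size_map => /(_ erefl).
      have [//|h] := boolP (map (env x) s \in supp (iid_law (bernoulli_law p) (size s))).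
      rewrite big_seq big1 => [/esym/eqP|e ed]; first by rewrite oner_eq0.
      case: eqP => [e2|]; last by rewrite mulr0.
      by move: h; rewrite -e2 map_f.
    by move=> [l [/iid_lawP[sl _] Ql] /(cylP _ us sl) ->].
  apply: fin_bigcup_measurable.
    apply: (@sub_finite_set _ _ [set` supp (iid_law (bernoulli_law p) (size s))]) => //.
    by move=> l [].
  by move=> l _.
transitivity (\int[P]_x (\1_[set x | Q (map (env x) s)] x)%:E)%E.
  by rewrite integral_indic// setIT.
apply: eq_integral => x _; rewrite indicE; congr (nat_of_bool _)%:R%:E.
by apply/idP/idP; rewrite inE.
Qed.

End Link.

(** * The law of the last passage time *)

(** The columns are listed from column [1] on, and the rows from row [0] on, each
starting at column [1]; hence the predecessors. *)
Definition colenv (cols : seq (seq bool)) : nat * nat -> bool :=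
  fun z => nth false (nth [::] cols z.1.-1) z.2.

Definition rowenv (rows : seq (seq bool)) : nat * nat -> bool :=
  fun z => nth false (nth [::] rows z.2) z.1.-1.

Lemma colenvE cols i j :
  colenv cols (i, j) = nth false (nth [::] cols i.-1) j.
Proof. by []. Qed.

Lemma rowenvE rows i j :
  rowenv rows (i, j) = nth false (nth [::] rows j) i.-1.
Proof. by []. Qed.

Lemma shift_colE k eta i j : shift (k, 0)%N eta (i, j) = eta ((k + i)%N, j).
Proof. by []. Qed.

(** The mean of [h] at the passage time to [(m, n)], with the columns as the
independent samples. *)
Definition Elpp {R : realType} (p : R) (h : nat -> R) (m n : nat) : R :=
  fmean (iid_law (iid_law (bernoulli_law p) n.+1) m) (fun cols => h (lpp (colenv cols) m n)).

(** The vertices whose weights matter for paths from [v] to [v + (m, n)], column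
by column; [rows_of] lists those for [v = (0, 0)] row by row. *)
Definition cols_of (v : nat * nat) (m n : nat) : seq (seq (nat * nat)) :=
  [seq [seq (v.1 + i.+1, v.2 + j)%N | j <- iota 0 n.+1] | i <- iota 0 m].

Definition box v m n : seq (nat * nat) := flatten (cols_of v m n).

Definition rows_of (m n : nat) : seq (seq (nat * nat)) :=
  [seq [seq (i.+1, j)%N | i <- iota 0 m] | j <- iota 0 n.+1].

Lemma colenv_cols_of eta v m n i j : (1 <= i <= m)%N -> (j <= n)%N ->
  colenv (map (map eta) (cols_of v m n)) (i, j) = shift v eta (i, j).
Proof.
move=> /andP[i1 im] jn; have im' : (i.-1 < m)%N by lia.
rewrite colenvE /cols_of -map_comp (nth_map 0%N) ?size_iota//.
rewrite /comp -map_comp (nth_map 0%N) ?size_iota// !nth_iota// /shift /=.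
by rewrite !add0n prednK.
Qed.

Lemma lpp_colenv eta v m n :
  lpp (shift v eta) m n = lpp (colenv (map (map eta) (cols_of v m n))) m n.
Proof. by apply: eq_lpp => i j im jn; rewrite colenv_cols_of. Qed.

Lemma lpp_rowenv eta k m n : (k <= m)%N ->
  lpp (shift (k, 0)%N eta) (m - k) n =
  lpp (shift (k, 0)%N (rowenv (map (map eta) (rows_of m n)))) (m - k) n.
Proof.
move=> km; apply: eq_lpp => i j /andP[i1 im] jn.
have im' : ((k + i).-1 < m)%N by lia.
rewrite !shift_colE rowenvE /rows_of -map_comp (nth_map 0%N) ?size_iota//.
rewrite /comp -map_comp (nth_map 0%N) ?size_iota// !nth_iota//.
by rewrite /= !add0n prednK// addn_gt0 i1 orbT.
Qed.

Lemma shape_const (A : eqType) (ss : seq (seq A)) k :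
  {in ss, forall s, size s = k} -> shape ss = nseq (size ss) k.
Proof.
elim: ss => //= s ss IH h; rewrite IH ?h ?mem_head// => s' h'.
by rewrite h// inE h' orbT.
Qed.

Lemma shape_cols_of v m n : shape (cols_of v m n) = nseq m n.+1.
Proof.
rewrite (@shape_const _ _ n.+1) ?size_map ?size_iota// => _ /mapP[i _ ->].
by rewrite size_map size_iota.
Qed.

Lemma mem_box v m n z1 z2 : ((z1, z2) \in box v m n) =
  (v.1 < z1 <= v.1 + m)%N && (v.2 <= z2 <= v.2 + n)%N.
Proof.
apply/flatten_mapP/idP => [[i]|/andP[h1 h2]].
  rewrite mem_iota => im /mapP[j]; rewrite mem_iota => jn [-> ->]; lia.
exists (z1 - v.1.+1)%N; first by rewrite mem_iota; lia.
apply/mapP; exists (z2 - v.2)%N; first by rewrite mem_iota; lia.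
by congr pair; lia.
Qed.

Lemma uniq_box v m n : uniq (box v m n).
Proof.
apply: (allpairs_uniq (f := fun i j => (v.1 + i.+1, v.2 + j)%N)).
- exact: iota_uniq.
- exact: iota_uniq.
move=> [i j] [i' j'] _ _ /= [] h1 h2; congr pair; lia.
Qed.

Lemma uniq_rows_of m n : uniq (flatten (rows_of m n)).
Proof.
apply: (allpairs_uniq (f := fun j i => (i.+1, j)%N)); try exact: iota_uniq.
by move=> [i j] [i' j'] _ _ /= [] -> ->.
Qed.

(** The product of functions of consecutive blocks of one word. *)
Definition prod_blocks {R : realType} (fs : seq (seq (nat * nat) * (seq bool -> R))) :=
  foldr (fun sf g l => sf.2 (take (size sf.1) l) * g (drop (size sf.1) l))
    (fun=> 1) fs.

Lemma fmean_prod_blocks {R : realType} (p : R) fs :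
  fmean (iid_law (bernoulli_law p) (size (flatten (map fst fs)))) (prod_blocks fs) =
  \prod_(sf <- fs) fmean (iid_law (bernoulli_law p) (size sf.1)) sf.2.
Proof.
elim: fs => [|[s f] fs IH]; first by rewrite fmean_iid0 big_nil.
rewrite big_cons /= size_cat fmean_iid_cat -IH -fmeanZr; apply: eq_fmean => l1 /iid_lawP[s1 _].
by rewrite -fmeanZ; apply: eq_fmean => l2 _; rewrite -s1 take_size_cat// drop_size_cat.
Qed.

Lemma prod_blocks_map {R : realType} (fs : seq (seq (nat * nat) * (seq bool -> R))) eta :
  prod_blocks fs (map eta (flatten (map fst fs))) = \prod_(sf <- fs) sf.2 (map eta sf.1).
Proof.
elim: fs => [|[s f] fs IH]; first by rewrite big_nil.
rewrite big_cons /= map_cat -IH -(size_map eta s).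
by rewrite take_size_cat// drop_size_cat.
Qed.

Section Law.
Context (d : measure_display) (T : measurableType d) (R : realType)
  (P : probability T R) (p : R) (omega : nat * nat -> {RV P >-> bool}).
Hypothesis omega_iid : iid_bernoulli p omega.

Let env := env omega.

Lemma expect_nested (ss : seq (seq (nat * nat))) k f : uniq (flatten ss) ->
  shape ss = nseq (size ss) k -> (forall ll, 0 <= f ll) ->
  'E_P[fun x => f (map (map (env x)) ss)]%E =
  (fmean (iid_law (iid_law (bernoulli_law p) k) (size ss)) f)%:E.
Proof.
move=> us shs f0.
pose g l := f (reshape (nseq (size ss) k) l).
have -> : (fun x => f (map (map (env x)) ss)) = (fun x => g (map (env x) (flatten ss))).
  apply/funext => x; rewrite /g map_flatten -shs; congr f.
  have -> : shape ss = shape (map (map (env x)) ss).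
    by rewrite /shape -map_comp; apply: eq_map => s /=; rewrite size_map.
  by rewrite flattenK.
rewrite (expect_finite omega_iid)//; last by move=> l; exact: f0.
congr EFin; have -> : size (flatten ss) = (size ss * k)%N.
  by rewrite size_flatten shs sumn_nseq mulnC.
rewrite fmean_iid_flatten; apply: eq_fmean => ll /iid_lawP[sl sub]; rewrite /g.
have -> : nseq (size ss) k = shape ll.
  by rewrite -sl (@shape_const _ _ k) // => l /sub /iid_lawP[].
by rewrite flattenK.
Qed.

(** By stationarity the corner [v] of the box is irrelevant; by locality the
environment may be replaced by one that is filled column by column. *)
Lemma expect_local v m n F : (forall eta, 0 <= F eta) ->
  (forall eta eta' : nat * nat -> bool,
    (forall i j, (1 <= i <= m)%N -> (j <= n)%N -> eta (i, j) = eta' (i, j)) ->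
    F eta = F eta') ->
  'E_P[fun x => F (shift v (env x))]%E =
  (fmean (iid_law (iid_law (bernoulli_law p) n.+1) m) (fun cols => F (colenv cols)))%:E.
Proof.
move=> F0 Floc.
have sz : size (cols_of v m n) = m by rewrite size_map size_iota.
have := @expect_nested (cols_of v m n) n.+1
  (fun cols => F (colenv cols)) (uniq_box v m n).
rewrite sz shape_cols_of => <- //.
congr expectation; apply/funext => x; apply: Floc => i j im jn.
by rewrite colenv_cols_of.
Qed.

Lemma expect_lpp (h : nat -> R) v m n : (forall k, 0 <= h k) ->
  'E_P[fun x => h (lpp (shift v (env x)) m n)]%E = (Elpp p h m n)%:E.
Proof.
move=> h0; apply: (expect_local v (F := fun eta => h (lpp eta m n))) => //.
by move=> eta eta' e; rewrite (eq_lpp e).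
Qed.

Lemma shift0 eta : shift (0, 0)%N eta = eta.
Proof. by apply/funext => -[]. Qed.

(** The same mean with the rows as the independent samples, as required when rows
are read as successive servers. *)
Lemma Elpp_rows (h : nat -> R) k m n : (forall k, 0 <= h k) -> (k <= m)%N ->
  Elpp p h (m - k) n = fmean (iid_law (iid_law (bernoulli_law p) m) n.+1)
    (fun rows => h (lpp (shift (k, 0)%N (rowenv rows)) (m - k) n)).
Proof.
move=> h0 km; apply: EFin_inj; rewrite -(@expect_lpp h (k, 0)%N)//.
have sz : size (rows_of m n) = n.+1 by rewrite size_map size_iota.
have := @expect_nested (rows_of m n) m
  (fun rows => h (lpp (shift (k, 0)%N (rowenv rows)) (m - k) n)) (uniq_rows_of m n).
rewrite sz => <- //.
  by congr expectation; apply/funext => x; rewrite lpp_rowenv.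
rewrite (@shape_const _ _ m) ?sz// => _ /mapP[j _ ->].
by rewrite size_map size_iota.
Qed.

(** Disjoint boxes share no vertex, so passage times through them are independent. *)
Lemma expect_boxes (I : Type) (r : seq I) (v : I -> nat * nat) (m n : I -> nat)
    (h : I -> nat -> R) :
  uniq (flatten [seq box (v i) (m i) (n i) | i <- r]) ->
  (forall i k, 0 <= h i k) ->
  'E_P[fun x => (\prod_(i <- r) h i (lpp (shift (v i) (env x)) (m i) (n i)))%R]%E
  = (\prod_(i <- r) Elpp p (h i) (m i) (n i))%:E.
Proof.
move=> ur h0.
pose f i l := h i (lpp (colenv (reshape (nseq (m i) (n i).+1) l)) (m i) (n i)).
have fE i eta : f i (map eta (box (v i) (m i) (n i))) =
    h i (lpp (shift (v i) eta) (m i) (n i)).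
  rewrite /f lpp_colenv /box map_flatten -(shape_cols_of (v i)).
  have -> : shape (cols_of (v i) (m i) (n i)) =
      shape (map (map eta) (cols_of (v i) (m i) (n i))).
    by rewrite /shape -map_comp; apply: eq_map => s /=; rewrite size_map.
  by rewrite flattenK.
pose fs := [seq (box (v i) (m i) (n i), f i) | i <- r].
have fsE : [seq box (v i) (m i) (n i) | i <- r] = map fst fs.
  by rewrite /fs -map_comp.
have -> : (fun x => \prod_(i <- r) h i (lpp (shift (v i) (env x)) (m i) (n i))) =
    (fun x => prod_blocks fs (map (env x) (flatten (map fst fs)))).
  apply/funext => x; rewrite prod_blocks_map big_map.
  by apply: eq_bigr => i _; rewrite -fE.
rewrite (expect_finite omega_iid).
- rewrite fmean_prod_blocks big_map; congr EFin; apply: eq_bigr => i _ /=.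
  apply: EFin_inj; rewrite -(expect_lpp (v i))//.
  rewrite -(expect_finite omega_iid).
  - by congr expectation; apply/funext => x; rewrite fE.
  - exact: uniq_box.
  - by move=> l; exact: h0.
- by rewrite -fsE.
- by rewrite /fs; elim: (r) => //= i r' IH l; rewrite mulr_ge0// h0.
Qed.

Lemma prob_lpp (Q : pred nat) m n :
  P [set x | Q (lpp (env x) m n)]%classic = (Elpp p (fun k => (Q k)%:R) m n)%:E.
Proof.
rewrite -(expect_lpp (0, 0)%N)//.
pose f l := Q (lpp (colenv (reshape (nseq m n.+1) l)) m n).
have fE eta : f (map eta (box (0, 0)%N m n)) = Q (lpp eta m n).
  rewrite /f -{2}(shift0 eta) lpp_colenv /box map_flatten -(shape_cols_of (0, 0)%N).
  have -> : shape (cols_of (0, 0)%N m n) = shape (map (map eta) (cols_of (0, 0)%N m n)).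
    by rewrite /shape -map_comp; apply: eq_map => s /=; rewrite size_map.
  by rewrite flattenK.
transitivity (P [set x | f (map (env x) (box (0, 0)%N m n))]%classic).
  by congr (P _); apply/seteqP; split => x /=; rewrite fE.
rewrite (prob_finite omega_iid) ?uniq_box// -(expect_finite omega_iid) ?uniq_box//.
by congr expectation; apply/funext => x; rewrite fE shift0.
Qed.

End Law.

(** * Tandem queues of finite capacity *)

Section Queue.

(** The increments of the passage time around a unit square form a queue: the
vertical increment [V] on the left is the number of customers, the weight [w] an
arrival, the horizontal increment [U] below a service. For an infinite buffer
the increments on the right and above are [V + w - U] (truncated) and
[max (w, U - V)]. A buffer of size [K] rejects arrivals when it is full; this
keeps all sums finite and, by reversibility, does not spoil the product form of
the equilibrium. *)
Variable K : nat.

Definition vstep (V : nat) (U w : bool) : nat := minn K (V + w - U).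

Definition istep (V : nat) (U w : bool) : bool :=
  if U then w || (V == 0)%N else w && (V < K)%N.

(** One row: the configuration [I] of horizontal increments below it, the initial
queue [V] and the weights [ws] give the configuration above it and the final queue. *)
Fixpoint qrow (V : nat) (I ws : seq bool) : seq bool * nat :=
  match I, ws with
  | U :: I', w :: ws' =>
      let r := qrow (vstep V U w) I' ws' in (istep V U w :: r.1, r.2)
  | _, _ => ([::], V)
  end.

(** The sum of the queues that leave the strip on the right, where [Vs] enter it
on the left. *)
Fixpoint qtot (Vs : seq nat) (I : seq bool) (rows : seq (seq bool)) : nat :=
  match Vs, rows with
  | V :: Vs', ws :: rows' =>
      let r := qrow V I ws in (r.2 + qtot Vs' r.1 rows')%N
  | _, _ => 0%N
  end.

Section Burke.
Context {R : realType}.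
Variables (p u rho : R).

(** The geometric law of ratio [rho] conditioned to [[0, K]]. *)
Definition geom_law : seq (R * nat) :=
  [seq (rho ^+ k / (\sum_(0 <= j < K.+1) rho ^+ j), k) | k <- iota 0 K.+1].

Lemma fmean_geom f : fmean geom_law f =
  (\sum_(0 <= k < K.+1) rho ^+ k * f k) / (\sum_(0 <= j < K.+1) rho ^+ j).
Proof.
rewrite /fmean big_map mulr_suml /index_iota subn0; apply: eq_bigr => k _ /=.
by rewrite mulrAC.
Qed.

(** Detailed balance: a queue grows with probability [p * (1 - u)] and shrinks with
probability [u * (1 - p)]. *)
Hypothesis balance : rho * (u * (1 - p)) = p * (1 - u).

(** Burke's theorem at one vertex: the outgoing pair of increments has the same
product law as the incoming pair. *)
Lemma burke_vertex (phi : bool -> nat -> R) :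
  fmean geom_law (fun V => fmean (bernoulli_law u) (fun U => fmean (bernoulli_law p) (fun w =>
    phi (istep V U w) (vstep V U w)))) =
  fmean geom_law (fun V => fmean (bernoulli_law u) (fun U => phi U V)).
Proof.
rewrite !fmean_geom; congr (_ / _).
under eq_bigr do rewrite !fmean_bernoulli.
under [RHS]eq_bigr do rewrite !fmean_bernoulli.
(* Departures at [V + 1] pair up with arrivals at [V]; the balance equation
   says that they carry the same weight. *)
pose dn k := rho ^+ k * (u * (1 - p)) * phi (k == 0)%N (minn K k.-1).
pose up k := rho ^+ k * (p * (1 - u)) * phi (k < K)%N (minn K k.+1).
pose st k := rho ^+ k * (u * p * phi true k + (1 - u) * (1 - p) * phi false k).
transitivity (\sum_(0 <= k < K.+1) (st k + dn k + up k)).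
  apply: eq_big_nat => k /andP[_ kK].
  rewrite /istep /vstep /st /dn /up /= !addn0 !addn1 !subn0 !subn1 /=.
  have -> : minn K k = k by lia.
  ring.
pose A k := rho ^+ k * (u * (1 - p)) * phi true k.
pose B k := rho ^+ k * (p * (1 - u)) * phi false k.
have sum_dn : \sum_(0 <= k < K.+1) dn k = A 0%N + \sum_(0 <= k < K) B k.
  rewrite big_nat_recl// /dn /A minn0; congr (_ + _).
  apply: eq_big_nat => k /andP[_ kK]; rewrite /B exprSr /= -(mulrA _ rho) balance.
  by have -> : minn K k = k by lia.
have sum_up : \sum_(0 <= k < K.+1) up k = \sum_(0 <= k < K) A k.+1 + B K.
  rewrite big_nat_recr//= /up ltnn; congr (_ + _); last first.
    by rewrite /B; have -> : minn K K.+1 = K by lia.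
  apply: eq_big_nat => k /andP[_ kK]; rewrite /A kK exprSr -(mulrA _ rho) balance.
  by have -> : minn K k.+1 = k.+1 by lia.
transitivity (\sum_(0 <= k < K.+1) st k + \sum_(0 <= k < K.+1) A k +
  \sum_(0 <= k < K.+1) B k).
  rewrite !big_split /= sum_dn sum_up [\sum_(0 <= k < K.+1) A k]big_nat_recl//.
  by rewrite [\sum_(0 <= k < K.+1) B k]big_nat_recr//=; ring.
rewrite -!big_split; apply: eq_bigr => k _ /=; rewrite /st /A /B; ring.
Qed.

Lemma burke_row m (phi : seq bool -> nat -> R) :
  fmean geom_law (fun V => fmean (iid_law (bernoulli_law u) m) (fun I =>
    fmean (iid_law (bernoulli_law p) m) (fun ws => phi (qrow V I ws).1 (qrow V I ws).2))) =
  fmean geom_law (fun V => fmean (iid_law (bernoulli_law u) m) (fun I => phi I V)).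
Proof.
elim: m phi => [|m IH] phi.
  by apply: eq_fmean => V _; rewrite !fmean_iid0.
have -> : fmean geom_law (fun V => fmean (iid_law (bernoulli_law u) m.+1) (fun I =>
    fmean (iid_law (bernoulli_law p) m.+1) (fun ws => phi (qrow V I ws).1 (qrow V I ws).2))) =
  fmean geom_law (fun V => fmean (bernoulli_law u) (fun U => fmean (bernoulli_law p) (fun w =>
    (fun i v => fmean (iid_law (bernoulli_law u) m) (fun I => fmean (iid_law (bernoulli_law p) m)
      (fun ws => phi (i :: (qrow v I ws).1) (qrow v I ws).2)))
    (istep V U w) (vstep V U w)))).
  apply: eq_fmean => V _; rewrite fmean_iidS; apply: eq_fmean => U _.
  under eq_fmean => I _ do rewrite fmean_iidS.
  by rewrite fmean_exchange.
rewrite (burke_vertex (fun i v => fmean (iid_law (bernoulli_law u) m) (fun I =>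
  fmean (iid_law (bernoulli_law p) m) (fun ws => phi (i :: (qrow v I ws).1) (qrow v I ws).2)))).
rewrite fmean_exchange; under eq_fmean => U _ do rewrite (IH (fun I v => phi (U :: I) v)).
rewrite fmean_exchange; apply: eq_fmean => V _.
by rewrite fmean_iidS.
Qed.

(** In equilibrium the queues that leave the strip are independent with the same
law as those that enter it, so the transform of their sum is a power. *)
Lemma burke_total th m nu :
  fmean (iid_law geom_law nu) (fun Vs => fmean (iid_law (bernoulli_law u) m) (fun I =>
    fmean (iid_law (iid_law (bernoulli_law p) m) nu) (fun rows =>
      expR (th * (qtot Vs I rows)%:R)))) =
  fmean (iid_law (bernoulli_law u) m) (fun=> fmean geom_law (fun V => expR (th * V%:R)) ^+ nu).
Proof.
elim: nu => [|nu IH].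
  rewrite fmean_iid0; apply: eq_fmean => I _.
  by rewrite fmean_iid0 mulr0 expR0 expr0.
set M := fmean geom_law _ in IH *.
rewrite fmean_iidS.
transitivity (fmean geom_law (fun V => fmean (iid_law (bernoulli_law u) m) (fun I =>
    fmean (iid_law (bernoulli_law p) m) (fun ws =>
      (fun I' V' => expR (th * V'%:R) * fmean (iid_law geom_law nu) (fun Vs =>
         fmean (iid_law (iid_law (bernoulli_law p) m) nu) (fun rows =>
           expR (th * (qtot Vs I' rows)%:R))))
      (qrow V I ws).1 (qrow V I ws).2)))).
  apply: eq_fmean => V _; rewrite fmean_exchange; apply: eq_fmean => I _.
  transitivity (fmean (iid_law geom_law nu) (fun Vs => fmean (iid_law (bernoulli_law p) m) (fun ws =>
      expR (th * (qrow V I ws).2%:R) * fmean (iid_law (iid_law (bernoulli_law p) m) nu) (fun rows =>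
           expR (th * (qtot Vs (qrow V I ws).1 rows)%:R))))).
    apply: eq_fmean => Vs _; rewrite fmean_iidS; apply: eq_fmean => ws _.
    by rewrite -fmeanZ; apply: eq_fmean => rows _; rewrite /= natrD mulrDr expRD.
  by rewrite fmean_exchange; apply: eq_fmean => ws _; rewrite fmeanZ.
rewrite (burke_row m (fun I' V' => expR (th * V'%:R) * fmean (iid_law geom_law nu) (fun Vs =>
         fmean (iid_law (iid_law (bernoulli_law p) m) nu) (fun rows =>
           expR (th * (qtot Vs I' rows)%:R))))).
transitivity (M * fmean (iid_law (bernoulli_law u) m) (fun I => fmean (iid_law geom_law nu) (fun Vs =>
         fmean (iid_law (iid_law (bernoulli_law p) m) nu) (fun rows =>
           expR (th * (qtot Vs I rows)%:R))))).
  by rewrite /M -fmeanZr; apply: eq_fmean => V _; rewrite fmeanZ.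
rewrite fmean_exchange IH -fmeanZ; apply: eq_fmean => I _.
by rewrite exprS.
Qed.

End Burke.

End Queue.

(** * The queues and the passage time *)

Definition psum (I : seq bool) (i : nat) : nat := count id (take i I).

Section QueuePaths.
Variable K : nat.
Local Open Scope nat_scope.

Lemma vstep_le V U w : vstep K V U w <= K.
Proof. exact: geq_minl. Qed.

Lemma step_conservation V U w : V <= K ->
  V + istep K V U w = vstep K V U w + U.
Proof. by rewrite /istep /vstep; case: U; case: w => /=; case: V => [|V] /=; lia. Qed.

Lemma size_qrow V I ws : size ws = size I -> size (qrow K V I ws).1 = size I.
Proof. by elim: I V ws => [|U I IH] V [|w ws]//= [sz]; rewrite IH. Qed.

Lemma qrow_conservation V I ws : size ws = size I -> V <= K ->
  V + count id (qrow K V I ws).1 = (qrow K V I ws).2 + count id I.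
Proof.
elim: I V ws => [|U I IH] V [|w ws]//= [sz] VK.
have := step_conservation U w VK; have := IH _ _ sz (vstep_le V U w); lia.
Qed.

Lemma psum_cons b I i : psum (b :: I) i.+1 = b + psum I i.
Proof. by []. Qed.

Lemma psum0 I : psum I 0 = 0.
Proof. by rewrite /psum take0. Qed.

Lemma psum_size I : psum I (size I) = count id I.
Proof. by rewrite /psum take_size. Qed.

(** The difference of the two sides is the queue at column [i]. *)
Lemma qrow_queue_ge0 V I ws i : size ws = size I -> V <= K ->
  psum I i <= V + psum (qrow K V I ws).1 i.
Proof.
elim: I V ws i => [|U I IH] V [|w ws] [|i]//= [sz] VK.
rewrite !psum_cons.
have := step_conservation U w VK; have := IH _ _ i sz (vstep_le V U w); lia.
Qed.

(** Either the buffer is full after column [i], or the arrival there was not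
rejected. *)
Lemma qrow_ge V I ws i : size ws = size I -> V <= K -> i < size I ->
  K + psum I i.+1 <= V + psum (qrow K V I ws).1 i.+1 \/
  psum (qrow K V I ws).1 i + nth false ws i <= psum (qrow K V I ws).1 i.+1.
Proof.
elim: I V ws i => [|U I IH] V [|w ws] i //= [sz] VK; case: i => [_|i iI].
  rewrite !psum_cons !psum0 /= /istep; case: U; case: w => /=; lia.
rewrite !psum_cons /=.
have := step_conservation U w VK; have := IH _ _ i sz (vstep_le V U w) iI; lia.
Qed.

(** Either the queue is empty after column [i], or no service was wasted there. *)
Lemma qrow_le V I ws i : size ws = size I -> V <= K -> i < size I ->
  V + psum (qrow K V I ws).1 i.+1 <= psum I i.+1 \/
  psum (qrow K V I ws).1 i.+1 <= psum (qrow K V I ws).1 i + nth false ws i.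
Proof.
elim: I V ws i => [|U I IH] V [|w ws] i //= [sz] VK; case: i => [_|i iI].
  rewrite !psum_cons !psum0 /= /istep; case: U; case: w => /=; lia.
rewrite !psum_cons /=.
have := step_conservation U w VK; have := IH _ _ i sz (vstep_le V U w) iI; lia.
Qed.

(** The first component accumulates the queues that entered on the left, so that
its sum with [psum] of the configuration is the height of the boundary model. *)
Fixpoint qstate (j : nat) (Vs : seq nat) (rows : seq (seq bool))
    (I : seq bool) (c : nat) : nat * seq bool :=
  match j, Vs, rows with
  | j'.+1, V :: Vs', ws :: rows' => qstate j' Vs' rows' (qrow K V I ws).1 (c + V)
  | _, _, _ => (c, I)
  end.

Lemma qstateS j Vs rows I c : size rows = size Vs -> j < size Vs ->
  qstate j.+1 Vs rows I c =
  ((qstate j Vs rows I c).1 + nth 0 Vs j,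
   (qrow K (nth 0 Vs j) (qstate j Vs rows I c).2 (nth [::] rows j)).1).
Proof.
elim: j Vs rows I c => [|j IH] [|V Vs] [|ws rows] // I c sz jV.
move: sz jV => [sz]; rewrite ltnS => jV.
rewrite -[LHS]/(qstate j.+1 Vs rows (qrow K V I ws).1 (c + V)).
by rewrite IH.
Qed.

Lemma qstate_total Vs rows I c : size rows = size Vs ->
  {in rows, forall ws, size ws = size I} -> {in Vs, forall V, V <= K} ->
  (qstate (size Vs) Vs rows I c).1 + count id (qstate (size Vs) Vs rows I c).2 =
  c + count id I + qtot K Vs I rows.
Proof.
elim: Vs rows I c => [|V Vs IH] [|ws rows]// I c sz szr VK.
  by rewrite /= addn0.
move: sz => [sz] /=.
have szw : size ws = size I by rewrite szr ?mem_head.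
rewrite IH//; last 2 first.
- by move=> ws' h; rewrite size_qrow// szr// inE h orbT.
- by move=> V' h; rewrite VK// inE h orbT.
have := qrow_conservation szw (VK _ (mem_head _ _)); lia.
Qed.

Section Comparison.
Variables (m n : nat) (Vs : seq nat) (rows : seq (seq bool)) (I : seq bool).
Hypotheses (szV : size Vs = n.+1) (szr : size rows = n.+1) (szI : size I = m).
Hypotheses (szw : {in rows, forall ws, size ws = m}).
Hypotheses (VK : {in Vs, forall V, V <= K}).

Let st j := qstate j Vs rows I 0.
Let eta := rowenv rows.

Let VsK j : nth 0 Vs j <= K.
Proof.
have [jV|jV] := ltnP j (size Vs); last by rewrite nth_default.
by rewrite VK// mem_nth.
Qed.

Let size_row j : j < n.+1 -> size (nth [::] rows j) = m.
Proof. by move=> jn; rewrite szw// mem_nth// szr. Qed.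

Let stS j : j < n.+1 -> st j.+1 =
  ((st j).1 + nth 0 Vs j, (qrow K (nth 0 Vs j) (st j).2 (nth [::] rows j)).1).
Proof. by move=> jn; rewrite /st qstateS ?szV ?szr. Qed.

Let size_st j : j <= n.+1 -> size (st j).2 = m.
Proof.
elim: j => [|j IH] jn; first by [].
by rewrite stS//= size_qrow ?size_row// IH// ltnW.
Qed.

Let st_total : (st n.+1).1 + psum (st n.+1).2 m = count id I + qtot K Vs I rows.
Proof.
rewrite -[X in psum _ X](size_st (leqnn _)) psum_size /st -szV qstate_total//.
  by rewrite szr.
by move=> ws /szw ->.
Qed.

Let st_sum j : j <= n.+1 -> (st j).1 = sumn (take j Vs).
Proof.
elim: j => [|j IH] jn; first by rewrite take0.
by rewrite stS//= IH 1?ltnW// (take_nth 0) ?szV// sumn_rcons.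
Qed.

(** The height of the boundary model obeys the recursion of [lpp] as an
inequality, except at a full buffer; but a full buffer alone already exceeds any
passage time over [m <= K] columns. *)
Lemma lpp_le_qtot : m <= K -> lpp eta m n <= count id I + qtot K Vs I rows.
Proof.
move=> mK; rewrite -st_total.
have main j : j < n.+1 -> forall i, i <= m ->
    lpp eta i j <= (st j.+1).1 + psum (st j.+1).2 i.
  elim: j => [|j IHj] jn; elim=> [|i IHi] im //.
    have {}IHi := IHi (ltnW im).
    have := @qrow_ge (nth 0 Vs 0) (st 0).2 (nth [::] rows 0) i.
    rewrite size_row// size_st// => /(_ erefl (VsK _) im).
    rewrite lppS0; move: IHi; rewrite stS//= /eta rowenvE /=.
    have := lpp_le (rowenv rows) i.+1 0; rewrite lppS0 rowenvE /=; lia.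
  have {}IHi := IHi (ltnW im).
  have {}IHj := IHj (ltnW jn) _ im.
  rewrite lppSS geq_max; apply/andP; split; last first.
    apply: (leq_trans IHj); rewrite (stS jn) /= -addnA leq_add2l.
    by apply: qrow_queue_ge0; rewrite ?size_row ?size_st// ltnW.
  have := @qrow_ge (nth 0 Vs j.+1) (st j.+1).2 (nth [::] rows j.+1) i.
  rewrite size_row// size_st ?(ltnW jn)// => /(_ erefl (VsK _) im).
  move: IHi; rewrite stS//= /eta rowenvE /=.
  have := lpp_le (rowenv rows) i.+1 j.+1.
  have := lpp_step1 (rowenv rows) i j.+1; rewrite rowenvE /=; lia.
exact: main.
Qed.

(** Conversely the height is at most the best value over the points where a path
can leave the boundary: where the queue is empty the height equals that of the
row below, elsewhere that of the previous column plus the weight, and following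
these steps back ends on the left or on the bottom boundary. *)
Lemma qtot_le_lpp :
  count id I + qtot K Vs I rows <= sumn Vs + lpp eta m n \/
  exists2 k, k <= m &
    count id I + qtot K Vs I rows <= psum I k + lpp (shift (k, 0) eta) (m - k) n.
Proof.
rewrite -st_total -[in sumn Vs](take_size Vs) szV.
have main j : j < n.+1 -> forall i, i <= m ->
    (st j.+1).1 + psum (st j.+1).2 i <= sumn (take j.+1 Vs) + lpp eta i j \/
    exists2 k, k <= i & (st j.+1).1 + psum (st j.+1).2 i <=
      psum I k + lpp (shift (k, 0) eta) (i - k) j.
  elim: j => [|j IHj] jn; elim=> [|i IHi] im.
  - by left; rewrite psum0 addn0 st_sum// leq_addr.
  - have := @qrow_le (nth 0 Vs 0) (st 0).2 (nth [::] rows 0) i.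
    rewrite size_row// size_st// => /(_ erefl (VsK _) im) [h|h].
      by right; exists i.+1 => //; rewrite subnn lpp0n addn0 stS.
    have {}h : psum (st 1).2 i.+1 <= psum (st 1).2 i + eta (i.+1, 0) by rewrite stS.
    have [h'|[k ki h']] := IHi (ltnW im).
      by left; have := lpp_step1 eta i 0; lia.
    right; exists k; first exact: leqW.
    have := lpp_step1 (shift (k, 0) eta) (i - k) 0.
    by rewrite shift_colE subSn// addnS subnKC//; lia.
  - by left; rewrite psum0 addn0 st_sum// leq_addr.
  - have := @qrow_le (nth 0 Vs j.+1) (st j.+1).2 (nth [::] rows j.+1) i.
    rewrite size_row// size_st ?(ltnW jn)// => /(_ erefl (VsK _) im) [h|h].
      have {}h : (st j.+2).1 + psum (st j.+2).2 i.+1 <=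
          (st j.+1).1 + psum (st j.+1).2 i.+1 by rewrite stS//=; lia.
      have [h'|[k ki h']] := IHj (ltnW jn) _ im.
        left; have := lpp_step2 eta i.+1 j.
        by rewrite [take j.+2 _](take_nth 0) ?szV// sumn_rcons; lia.
      by right; exists k => //; have := lpp_step2 (shift (k, 0) eta) (i.+1 - k) j; lia.
    have {}h : psum (st j.+2).2 i.+1 <= psum (st j.+2).2 i + eta (i.+1, j.+1).
      by rewrite stS.
    have [h'|[k ki h']] := IHi (ltnW im).
      by left; have := lpp_step1 eta i j.+1; lia.
    right; exists k; first exact: leqW.
    have := lpp_step1 (shift (k, 0) eta) (i - k) j.+1.
    by rewrite shift_colE subSn// addnS subnKC//; lia.
exact: main.
Qed.

End Comparison.
End QueuePaths.

(** * Truncated geometric laws *)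

Section TruncatedGeometric.
Context {R : realType}.
Variables (rho : R) (K : nat).
Hypotheses (rho_gt0 : 0 < rho) (rho_lt1 : rho < 1).

Let Z := \sum_(0 <= j < K.+1) rho ^+ j.

Lemma geo_weight_ge1 : 1 <= Z.
Proof.
rewrite /Z big_nat_recl// expr0 lerDl; apply: sumr_ge0 => i _.
by rewrite exprn_ge0 ?ltW.
Qed.

Let Z_gt0 : 0 < Z. Proof. exact: lt_le_trans geo_weight_ge1. Qed.

Lemma isdist_geom : isdist (geom_law K rho).
Proof.
split.
  apply/allP => _ /mapP[k _ ->] /=.
  by rewrite divr_ge0 ?exprn_ge0 ?ltW.
have := fmean_geom K rho (fun=> 1); rewrite /fmean; under eq_bigr do rewrite mulr1.
by move=> ->; under eq_bigr do rewrite mulr1; rewrite divff// gt_eqF.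
Qed.

Lemma supp_geom k : k \in supp (geom_law K rho) -> (k <= K)%N.
Proof. by move=> /mapP[_ /mapP[j jK ->] ->] /=; move: jK; rewrite mem_iota. Qed.

Lemma mean_geom : fmean (geom_law K rho) (fun V => V%:R) =
  rho / (1 - rho) - K.+1%:R * rho ^+ K.+1 / ((1 - rho) * Z).
Proof.
have r1 : 1 - rho != 0 by rewrite gt_eqF// subr_gt0.
have ZE : Z = (1 - rho ^+ K.+1) / (1 - rho).
  apply: (canRL (mulfK r1)); rewrite /Z; elim: K => [|k IH].
    by rewrite big_nat1; ring.
  by rewrite big_nat_recr//= mulrDl IH [rho ^+ k.+2]exprSr; ring.
have SE : \sum_(0 <= k < K.+1) rho ^+ k * k%:R =
    rho / (1 - rho) * Z - K.+1%:R * rho ^+ K.+1 / (1 - rho).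
  rewrite ZE; elim: K => [|k IH].
    by rewrite big_nat1; field.
  rewrite big_nat_recr//= IH [rho ^+ k.+2]exprSr [rho ^+ k.+1]exprSr -!natr1; field.
  by [].
rewrite fmean_geom SE -/Z mulrBl mulfK ?gt_eqF//; congr (_ - _).
by rewrite invfM mulrA.
Qed.

Lemma mean_geom_le : fmean (geom_law K rho) (fun V => V%:R) <= rho / (1 - rho).
Proof.
rewrite mean_geom lerBlDr lerDl.
by rewrite divr_ge0 ?mulr_ge0 ?exprn_ge0 ?subr_ge0 ?(ltW rho_gt0) ?(ltW rho_lt1) ?(ltW Z_gt0).
Qed.

Lemma mean_geom_ge : rho / (1 - rho) - K.+1%:R * rho ^+ K.+1 / (1 - rho) <=
  fmean (geom_law K rho) (fun V => V%:R).
Proof.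
rewrite mean_geom lerB// ler_wpM2l//.
  by rewrite mulr_ge0// exprn_ge0// ltW.
rewrite lef_pV2 ?posrE ?mulr_gt0// ?subr_gt0//.
by rewrite ler_peMr ?geo_weight_ge1// subr_ge0 ltW.
Qed.

End TruncatedGeometric.

Lemma expR_dominates (R : realType) (c C : R) : 0 < c ->
  exists N0, forall N, (N0 <= N)%N -> C * N.+1%:R <= expR (c * N%:R).
Proof.
move=> c0; pose M := (`|C| + 1) * 8 / c ^+ 2 + 1.
exists (Num.truncn M).+1 => N hN.
have MN : M < N%:R.
  by apply: lt_le_trans (truncnS_gt _) _; rewrite ler_nat.
have C0 := normr_ge0 C; have CC := ler_norm C.
have h8 : (`|C| + 1) * 8 <= c ^+ 2 * N%:R.
  have : (`|C| + 1) * 8 / c ^+ 2 <= N%:R by rewrite /M in MN; lra.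
  by rewrite ler_pdivrMr ?exprn_gt0// [c ^+ 2 * _]mulrC.
have N1 : 1 <= N%:R :> R.
  have : 0 <= (`|C| + 1) * 8 / c ^+ 2 by rewrite divr_ge0 ?sqr_ge0//; lra.
  by rewrite /M in MN; lra.
apply: (@le_trans _ _ ((c / 2 * N%:R) ^+ 2)).
  rewrite -natr1 exprMn exprMn; nra.
have -> : c * N%:R = c / 2 * N%:R + c / 2 * N%:R by field.
rewrite expRD -expr2 lerXn2r ?nnegrE ?expR_ge0//.
  by rewrite mulr_ge0// divr_ge0// ltW.
by apply: le_trans (expR_ge1Dx _); rewrite lerDr.
Qed.

(** * Bounds on the mean passage time *)

Section Mean.
Context (d : measure_display) (T : measurableType d) (R : realType)
  (P : probability T R) (p : R) (omega : nat * nat -> {RV P >-> bool}).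
Hypotheses (omega_iid : iid_bernoulli p omega) (p_gt0 : 0 < p) (p_lt1 : p < 1).

Definition meanG (m n : nat) : R := Elpp p (fun k => k%:R) m n.

Let isdist_p : isdist (bernoulli_law p).
Proof. by apply: isdist_bernoulli; rewrite !ltW. Qed.

Lemma isdist_cols m n : isdist (iid_law (iid_law (bernoulli_law p) n) m).
Proof. by do 2 apply: isdist_iid. Qed.

(** The box may be enlarged, which puts passage times to several endpoints on the
same finite sample space. *)
Lemma Elpp_widen (h : nat -> R) m n m' n' : (forall k, 0 <= h k) ->
  (m <= m')%N -> (n <= n')%N ->
  Elpp p h m n = fmean (iid_law (iid_law (bernoulli_law p) n'.+1) m')
    (fun cols => h (lpp (colenv cols) m n)).
Proof.
move=> h0 mm' nn'; apply: EFin_inj; rewrite -(expect_lpp omega_iid (0, 0)%N)//.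
apply: (expect_local omega_iid (0, 0)%N (F := fun eta => h (lpp eta m n))) => //.
move=> eta eta' e; congr h; apply: eq_lpp => i j /andP[i1 im] jn.
by rewrite e ?i1 ?(leq_trans im)// (leq_trans jn).
Qed.

Lemma Elpp_rows0 (h : nat -> R) m n : (forall k, 0 <= h k) ->
  Elpp p h m n = fmean (iid_law (iid_law (bernoulli_law p) m) n.+1)
    (fun rows => h (lpp (rowenv rows) m n)).
Proof.
move=> h0; have := @Elpp_rows _ _ _ _ _ _ omega_iid h 0 m n h0 (leq0n m).
by rewrite subn0 => ->; apply: eq_fmean => rows _; rewrite shift0.
Qed.

Lemma Elpp_ge0 h m n : (forall k, 0 <= h k) -> 0 <= Elpp p h m n.
Proof. by move=> h0; apply: fmean_ge0 => //; exact: isdist_cols. Qed.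

Lemma Elpp_le h h' m n : (forall k, (k <= m)%N -> h k <= h' k) ->
  Elpp p h m n <= Elpp p h' m n.
Proof.
move=> hh; apply: ler_fmean; first exact: isdist_cols.
by move=> cols _; apply: hh; exact: lpp_le.
Qed.

Lemma Elpp_mono (h : nat -> R) m n m' n' : (forall k, 0 <= h k) ->
  (forall k l, (k <= l)%N -> h k <= h l) ->
  (m <= m')%N -> (n <= n')%N -> Elpp p h m n <= Elpp p h m' n'.
Proof.
move=> h0 hm mm' nn'; rewrite (Elpp_widen h0 mm' nn').
apply: ler_fmean; first exact: isdist_cols.
by move=> cols _; apply: hm; exact: lpp_mono.
Qed.

Lemma meanG_mono m n m' n' : (m <= m')%N -> (n <= n')%N ->
  meanG m n <= meanG m' n'.
Proof. by apply: Elpp_mono => // k l kl; rewrite ler_nat. Qed.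

Lemma meanG_le m n : meanG m n <= m%:R.
Proof.
rewrite -(fmean_cst (isdist_cols m n.+1) m%:R); apply: ler_fmean.
  exact: isdist_cols.
by move=> cols _; rewrite ler_nat lpp_le.
Qed.

Lemma meanG_lip a b n : (a <= b)%N -> meanG b n <= meanG a n + (b - a)%N%:R.
Proof.
move=> ab; rewrite /meanG (@Elpp_widen _ a n b n)//.
rewrite -(fmean_cst (isdist_cols b n.+1) (b - a)%N%:R) -fmeanD.
apply: ler_fmean; first exact: isdist_cols.
move=> cols _; rewrite -natrD ler_nat -{1}(subnKC ab).
elim: (b - a)%N => [|k IH]; first by rewrite !addn0.
by rewrite !addnS (leq_trans (lpp_lip _ _ _)).
Qed.

(** Concentration, the columns being the independent samples. *)
Lemma Elpp_mgf th m n : `|th| <= 2^-1 ->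
  Elpp p (fun k => expR (th * k%:R)) m n <= expR (th * meanG m n + 2 * m%:R * th ^+ 2).
Proof.
move=> th2; apply: (mgf_iid (F := fun cols => (lpp (colenv cols) m n)%:R)) => //.
  exact: isdist_iid.
move=> l1 a b l2 sz.
have col a' b' (i j : nat) : (0 < i)%N -> i != (size l1).+1 ->
    colenv (l1 ++ a' :: l2) (i, j) = colenv (l1 ++ b' :: l2) (i, j).
  case: i => // i _; rewrite eqSS => il; rewrite !colenvE !nth_cat.
  case: ltnP => //= h; have pos : (0 < i - size l1)%N.
    by rewrite subn_gt0 ltn_neqAle eq_sym il.
  by rewrite -(prednK pos).
have h1 := lpp_column_change m n (col a b).
have h2 := lpp_column_change m n (col b a).
move: h1 h2; rewrite -!(ler_nat R) !natrD => h1 h2.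
by rewrite ler_norml; apply/andP; split; lra.
Qed.

Section Boundary.
Variable u : R.
Hypotheses (pu : p < u) (u1 : u < 1).

Let rho := p * (1 - u) / (u * (1 - p)).

(** The mean of the untruncated geometric law of ratio [rho], when [w = u]. *)
Definition vmean (w : R) : R := p * (1 - w) / (w - p).

Let u_gt0 : 0 < u. Proof. exact: lt_trans pu. Qed.
Let den_gt0 : 0 < u * (1 - p). Proof. by rewrite mulr_gt0// subr_gt0. Qed.

Let isdist_u : isdist (bernoulli_law u).
Proof. by apply: isdist_bernoulli; rewrite !ltW. Qed.

Let balance : rho * (u * (1 - p)) = p * (1 - u).
Proof. by rewrite /rho divfK// gt_eqF. Qed.

Let rho_gt0 : 0 < rho.
Proof. by rewrite divr_gt0// mulr_gt0// subr_gt0. Qed.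

Let rho_lt1 : rho < 1.
Proof.
rewrite /rho ltr_pdivrMr// mul1r -subr_gt0.
by have -> : u * (1 - p) - p * (1 - u) = u - p; [ring | rewrite subr_gt0].
Qed.

Let rho_vmean : rho / (1 - rho) = vmean u.
Proof.
have h : u - p != 0 by rewrite gt_eqF// subr_gt0.
have h1 : 1 - p != 0 by rewrite gt_eqF// subr_gt0.
by rewrite /rho /vmean; field; rewrite h h1 gt_eqF.
Qed.

Lemma fmean_count m : fmean (iid_law (bernoulli_law u) m) (fun I => (count id I)%:R) = m%:R * u.
Proof.
elim: m => [|m IH]; first by rewrite fmean_iid0 mul0r.
rewrite fmean_iidS fmean_bernoulli /=.
have du := isdist_iid m isdist_u.
rewrite (eq_fmean (g := fun l => 1 + (count id l)%:R)); last by move=> l _; rewrite natrD.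
rewrite fmeanD fmean_cst// IH -natr1; ring.
Qed.

(** The passage time is dominated by the equilibrium model of any bottom density
[u > p], whose mean is explicit. The transform at parameter [th] gives the bound up to an
error of order [th]. *)
Lemma mean_upper m n : meanG m n <= m%:R * u + n.+1%:R * vmean u.
Proof.
pose K := m.+1.
have dg := isdist_geom K rho_gt0.
have step th : 0 < th -> th * K%:R <= 2^-1 ->
    meanG m n - m%:R * u <= n.+1%:R * (vmean u + 2 * th * K%:R ^+ 2).
  move=> th0 thK.
  rewrite -(ler_pM2l th0) -ler_expR.
  set M := fmean (geom_law K rho) (fun V => expR (th * V%:R)).
  have MK : M <= expR (th * (vmean u + 2 * th * K%:R ^+ 2)).
    have K0 : 0 < K%:R :> R by rewrite ltr0n.
    have := @mgf_le _ _ _ dg (th * K%:R) (fun V => V%:R / K%:R).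
    rewrite ger0_norm ?mulr_ge0 ?(ltW th0)// => /(_ thK).
    rewrite (eq_fmean (g := fun V => expR (th * V%:R))); last first.
      by move=> V _; congr expR; field; rewrite gt_eqF.
    move=> h; apply: (le_trans (h _)).
      move=> a b /supp_geom aK /supp_geom bK.
      rewrite -mulrBl normrM (ger0_norm (x := K%:R^-1)) ?invr_ge0//.
      rewrite ler_pdivrMr// mul1r ler_norml.
      move: aK bK; rewrite -!(ler_nat R) => aK bK.
      have := ler0n R a; have := ler0n R b; lra.
    rewrite ler_expR fmeanZr.
    have -> : th * K%:R * (fmean (geom_law K rho) (fun a => a%:R) / K%:R) =
        th * fmean (geom_law K rho) (fun a => a%:R) by field; rewrite gt_eqF.
    have := mean_geom_le K rho_gt0 rho_lt1; rewrite rho_vmean => hv.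
    have -> : 2 * (th * K%:R) ^+ 2 = th * (2 * th * K%:R ^+ 2) by ring.
    by rewrite mulrDr lerD2r ler_pM2l.
  have M0 : 0 <= M by apply: fmean_ge0 => // a; exact: expR_ge0.
  apply: (@le_trans _ _ (M ^+ n.+1)); last first.
    rewrite mulrCA expRM_natl.
    by apply: lerXn2r => //; rewrite nnegrE// expR_ge0.
  have <- : fmean (iid_law (bernoulli_law u) m) (fun=> M ^+ n.+1) = M ^+ n.+1.
    by rewrite fmean_cst//; exact: isdist_iid.
  rewrite -(burke_total K balance).
  rewrite mulrBr expRD.
  apply: (@le_trans _ _ (fmean (iid_law (geom_law K rho) n.+1) (fun=>
    fmean (iid_law (bernoulli_law u) m) (fun I => fmean (iid_law (iid_law (bernoulli_law p) m) n.+1)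
      (fun rows => expR (th * (lpp (rowenv rows) m n)%:R) *
                   expR (- th * (count id I)%:R)))))).
    rewrite fmean_cst; last exact: isdist_iid.
    under eq_fmean do rewrite fmeanZr.
    rewrite fmeanZ ler_pM ?expR_ge0//; last first.
      by rewrite -mulNr -fmean_count; apply: jensen_expR; exact: isdist_iid.
    rewrite -(Elpp_rows0 (h := fun k => expR (th * k%:R))).
      by apply: jensen_expR; exact: isdist_cols.
    by move=> k; exact: expR_ge0.
  apply: ler_fmean; first exact: isdist_iid.
  move=> Vs /iid_lawP[sV VK].
  apply: ler_fmean; first exact: isdist_iid.
  move=> I /iid_lawP[sI _].
  apply: ler_fmean; first by do 2 apply: isdist_iid.
  move=> rows /iid_lawP[sr rm].
  rewrite -expRD ler_expR mulNr -mulrBr ler_pM2l// lerBlDr -natrD ler_nat addnC.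
  apply: lpp_le_qtot => //.
  - by move=> ws /rm /iid_lawP[].
  - by move=> V /VK /supp_geom.
have K0 : 0 < K%:R :> R by rewrite ltr0n.
have n0 : 0 < n.+1%:R :> R by rewrite ltr0n.
rewrite -lerBlDl; apply/ler_addgt0Pr => e e0.
pose th := Num.min (2^-1 / K%:R) (e / (n.+1%:R * 2 * K%:R ^+ 2)).
have th0 : 0 < th by rewrite lt_min !divr_gt0// ?mulr_gt0// exprn_gt0.
apply: (le_trans (step th th0 _)).
  by rewrite -ler_pdivlMr// ge_min lexx.
rewrite mulrDr lerD2l.
have : th <= e / (n.+1%:R * 2 * K%:R ^+ 2) by rewrite ge_min lexx orbT.
rewrite ler_pdivlMr ?mulr_gt0 ?exprn_gt0//.
by apply: le_trans; rewrite le_eqVlt; apply/orP; left; apply/eqP; ring.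
Qed.


Lemma mgf_bernoulli_neg th : `|th| <= 2^-1 ->
  fmean (bernoulli_law u) (fun U => expR (- th * (U : nat)%:R)) <=
  expR (- th * u + 2 * th ^+ 2).
Proof.
move=> th2; have := @mgf_le _ _ _ isdist_u (- th) (fun U : bool => (U : nat)%:R).
rewrite normrN sqrrN => /(_ th2) h; apply: (le_trans (h _)).
  by move=> [] [] _ _; rewrite ?subrr ?normr0 ?ler01// ?subr0 ?sub0r ?normrN normr1.
by rewrite [fmean _ _ in leLHS]fmean_bernoulli mulr0 addr0 mulr1.
Qed.

(** An upper bound for the transform of the passage time through the last [a]
columns minus [a] Bernoulli(u) increments: a path that leaves the bottom boundary
[a] columns before the end contributes this much. *)
Definition exit_weight (th : R) (n a : nat) : R :=
  expR (th * (meanG a n - a%:R * u + 4 * th * a%:R)).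

Lemma exit_weight_ge th n a : 0 <= th <= 2^-1 ->
  Elpp p (fun k => expR (th * k%:R)) a n *
    fmean (bernoulli_law u) (fun U => expR (- th * (U : nat)%:R)) ^+ a <= exit_weight th n a.
Proof.
move=> /andP[th0 th2]; have nth2 : `|th| <= 2^-1 by rewrite ger0_norm.
have -> : exit_weight th n a =
    expR (th * meanG a n + 2 * a%:R * th ^+ 2) * expR (- th * u + 2 * th ^+ 2) ^+ a.
  rewrite -expRM_natl -expRD /exit_weight; congr expR; ring.
apply: ler_pM; last 2 first.
- exact: Elpp_mgf.
- apply: lerXn2r; rewrite ?nnegrE ?expR_ge0//; last exact: mgf_bernoulli_neg.
  by apply: fmean_ge0 => // U; exact: expR_ge0.
- by apply: Elpp_ge0 => k; exact: expR_ge0.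
- by apply: exprn_ge0; apply: fmean_ge0 => // U; exact: expR_ge0.
Qed.

(** The maximum over the exit points is at most the sum. The factor
[1 - exit_weight th n m] accounts for the paths that leave the left boundary,
which lose against [m] bottom increments when [m] is large. *)
Lemma mean_lower_sum th K m n : 0 <= th <= 2^-1 -> exit_weight th n m <= 1 ->
  expR (th * (n.+1%:R * fmean (geom_law K rho) (fun V => V%:R))) *
    (1 - exit_weight th n m) <= \sum_(0 <= a < m.+1) exit_weight th n a.
Proof.
move=> thI ew1; have dg := isdist_geom K rho_gt0.
set M := fmean (geom_law K rho) (fun V => expR (th * V%:R)).
set be := fmean (bernoulli_law u) (fun U => expR (- th * (U : nat)%:R)).
pose L a := Elpp p (fun k => expR (th * k%:R)) a n.
have MJ : expR (th * (n.+1%:R * fmean (geom_law K rho) (fun V => V%:R))) <= M ^+ n.+1.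
  rewrite mulrCA expRM_natl; apply: lerXn2r; rewrite ?nnegrE ?expR_ge0//.
    by apply: fmean_ge0 => // a; exact: expR_ge0.
  exact: jensen_expR.
have M0 : 0 <= M ^+ n.+1 by apply: le_trans MJ; exact: expR_ge0.
suff main : M ^+ n.+1 <= M ^+ n.+1 * (L m * be ^+ m) +
    \sum_(0 <= k < m.+1) L (m - k)%N * be ^+ (m - k).
  apply: (@le_trans _ _ (M ^+ n.+1 * (1 - exit_weight th n m))).
    by rewrite ler_wpM2r// subr_ge0.
  rewrite mulrBr mulr1 lerBlDr (le_trans main)// addrC lerD//; last first.
    by rewrite ler_wpM2l// exit_weight_ge.
  rewrite big_nat_rev /= add0n; apply: ler_sum_nat => k /andP[_ km].
  by rewrite subSS subKn// exit_weight_ge.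
have count_drop k : (k <= m)%N ->
    fmean (iid_law (bernoulli_law u) m) (fun I => expR (- th * (count id (drop k I))%:R)) =
    be ^+ (m - k).
  move=> km; rewrite -{1}(subnKC km) fmean_iid_cat.
  have E l1 : l1 \in supp (iid_law (bernoulli_law u) k) ->
      fmean (iid_law (bernoulli_law u) (m - k))
        (fun l2 => expR (- th * (count id (drop k (l1 ++ l2)))%:R)) = be ^+ (m - k).
    move=> /iid_lawP[s1 _]; rewrite /be -fmean_iid_prod; apply: eq_fmean => l2 _.
    rewrite -s1 drop_size_cat//; elim: l2 => [|b l2 IH].
      by rewrite big_nil mulr0 expR0.
    by rewrite big_cons -IH -expRD /= natrD mulrDr.
  by rewrite (eq_fmean E) fmean_cst//; exact: isdist_iid.
have sumVs : fmean (iid_law (geom_law K rho) n.+1) (fun Vs => expR (th * (sumn Vs)%:R)) = M ^+ n.+1.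
  rewrite -fmean_iid_prod; apply: eq_fmean => Vs _.
  elim: Vs => [|V Vs IH]; first by rewrite big_nil mulr0 expR0.
  by rewrite big_cons -IH -expRD /= natrD mulrDr.
have <- : fmean (iid_law (bernoulli_law u) m) (fun=> M ^+ n.+1) = M ^+ n.+1.
  by rewrite fmean_cst//; exact: isdist_iid.
rewrite -{1}(burke_total K balance).
have dVs := isdist_iid n.+1 dg.
have dI := isdist_iid m isdist_u.
have dr : isdist (iid_law (iid_law (bernoulli_law p) m) n.+1) by do 2 apply: isdist_iid.
apply: (@le_trans _ _ (fmean (iid_law (geom_law K rho) n.+1) (fun Vs =>
    fmean (iid_law (bernoulli_law u) m) (fun I => fmean (iid_law (iid_law (bernoulli_law p) m) n.+1)
      (fun rows => expR (th * (sumn Vs)%:R) * (expR (- th * (count id (drop 0 I))%:R)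
          * expR (th * (lpp (rowenv rows) m n)%:R)) +
        \sum_(0 <= k < m.+1) expR (- th * (count id (drop k I))%:R) *
          expR (th * (lpp (shift (k, 0)%N (rowenv rows)) (m - k) n)%:R)))))).
  apply: ler_fmean => // Vs /iid_lawP[sV VK]; apply: ler_fmean => // I /iid_lawP[sI _].
  apply: ler_fmean => // rows /iid_lawP[sr rm].
  have th0 : 0 <= th by case/andP: thI.
  have sum0 : 0 <= \sum_(0 <= k < m.+1) expR (- th * (count id (drop k I))%:R) *
      expR (th * (lpp (shift (k, 0)%N (rowenv rows)) (m - k) n)%:R).
    by apply: sumr_ge0 => k _; rewrite mulr_ge0 ?expR_ge0.
  have [] := @qtot_le_lpp K m n Vs rows I sV sr sI.
  - by move=> ws /rm /iid_lawP[].
  - by move=> V /VK /supp_geom.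
  - move=> h; rewrite ler_wpDr// -!expRD ler_expR drop0.
    have E (x y z : R) : th * x + (- th * y + th * z) = th * (x - y + z) by ring.
    rewrite E ler_wpM2l//; move: h; rewrite -(ler_nat R) !natrD; lra.
  - move=> [k km h]; apply: ler_wpDl; first by rewrite !mulr_ge0 ?expR_ge0.
    rewrite (bigD1_seq k) ?iota_uniq ?mem_index_iota//=.
    apply: ler_wpDr; first by apply: sumr_ge0 => j _; rewrite mulr_ge0 ?expR_ge0.
    have E (x y : R) : - th * x + th * y = th * (y - x) by ring.
    rewrite -expRD ler_expR E ler_wpM2l//.
    have : (psum I k + count id (drop k I) = count id I)%N.
      by rewrite /psum -count_cat cat_take_drop.
    by move: h; rewrite -(ler_nat R) => + /(congr1 (fun x => x%:R : R)); rewrite !natrD; lra.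
rewrite le_eqVlt; apply/orP; left; apply/eqP.
rewrite fmean_cst//.
have inner Vs I : fmean (iid_law (iid_law (bernoulli_law p) m) n.+1)
      (fun rows => expR (th * (sumn Vs)%:R) * (expR (- th * (count id (drop 0 I))%:R)
          * expR (th * (lpp (rowenv rows) m n)%:R)) +
        \sum_(0 <= k < m.+1) expR (- th * (count id (drop k I))%:R) *
          expR (th * (lpp (shift (k, 0)%N (rowenv rows)) (m - k) n)%:R)) =
    expR (th * (sumn Vs)%:R) * (expR (- th * (count id (drop 0 I))%:R) * L m) +
    \sum_(0 <= k < m.+1) expR (- th * (count id (drop k I))%:R) * L (m - k)%N.
  rewrite fmeanD fmeanZ fmeanZ fmean_sum; congr (_ + _).
    by rewrite /L Elpp_rows0// => k; exact: expR_ge0.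
  apply: eq_big_nat => k /andP[_ km]; rewrite fmeanZ; congr (_ * _).
  by rewrite /L (Elpp_rows omega_iid)// => j; exact: expR_ge0.
under eq_fmean => Vs _.
  under eq_fmean => I _ do rewrite inner.
  rewrite fmeanD fmeanZ fmeanZr count_drop// subn0 fmean_sum.
  over.
rewrite fmeanD fmeanZr sumVs fmean_cst//; congr (_ + _); first by rewrite [L m * _]mulrC.
apply: eq_big_nat => k /andP[_ km].
by rewrite fmeanZr count_drop// mulrC.
Qed.

Lemma exists_buffer e : 0 < e ->
  exists K, vmean u - e <= fmean (geom_law K rho) (fun V => V%:R).
Proof.
move=> e0; have r1 : 0 < 1 - rho by rewrite subr_gt0.
have lnr : 0 < - ln rho by rewrite oppr_gt0 ln_lt0// rho_gt0.
have [N0 hN] := expR_dominates ((e * (1 - rho))^-1) lnr.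
exists N0; have := mean_geom_ge N0 rho_gt0 rho_lt1; rewrite rho_vmean.
apply: le_trans; rewrite lerD2l lerN2 ler_pdivrMr//.
have := hN _ (leqnSn N0).
have -> : expR (- ln rho * N0.+1%:R) = (rho ^+ N0.+1)^-1.
  by rewrite mulNr expRN mulrC expRM_natl lnK// posrE.
have er : 0 < e * (1 - rho) by rewrite mulr_gt0.
have rk : 0 < rho ^+ N0.+1 by rewrite exprn_gt0.
rewrite ler_pdivrMl// ler_pdivlMr//.
by apply: le_trans; rewrite ler_wpM2r ?(ltW rk)// ler_nat.
Qed.

End Boundary.
End Mean.

(** * The law of large numbers for the mean *)

Section MeanLimit.
Context (d : measure_display) (T : measurableType d) (R : realType)
  (P : probability T R) (p : R) (omega : nat * nat -> {RV P >-> bool}).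
Hypotheses (omega_iid : iid_bernoulli p omega) (p_gt0 : 0 < p) (p_lt1 : p < 1).

Lemma vmeanE w : p < w -> vmean p w = p * (1 - p) / (w - p) - p.
Proof.
move=> pw; have h : w - p != 0 by rewrite gt_eqF// subr_gt0.
by rewrite /vmean; field.
Qed.

Lemma vmean_ge0 w : p < w -> w < 1 -> 0 <= vmean p w.
Proof. by move=> pw w1; rewrite divr_ge0 ?mulr_ge0// ?subr_ge0 ltW. Qed.

Lemma truncnP (x : R) : 0 <= x -> (Num.truncn x)%:R <= x < (Num.truncn x)%:R + 1.
Proof. by move=> x0; rewrite natr1; exact: truncn_itv. Qed.

(** [(s, t)] is the direction in which [u = p + y] minimizes
[w |-> s * w + t * vmean p w]; the last hypothesis is the equation of the critical
point. *)
Section Characteristic.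
Variables (s t y : R).
Hypotheses (s_gt0 : 0 < s) (t_gt0 : 0 < t) (y_gt0 : 0 < y) (y_lt : y < 1 - p).
Hypothesis yst : p * (1 - p) * t = y ^+ 2 * s.

Let u := p + y.
Let v := vmean p u.
Let A (N : nat) := Num.truncn (N%:R * s).
Let n (N : nat) := Num.truncn (N%:R * t).

(** As [u] is critical, changing the density by [delta] costs only a term of order
[delta ^+ 2]. *)
Lemma vmean_left delta eta : 0 < delta -> delta <= y / 2 ->
  delta <= eta * y / (8 * s) ->
  t * vmean p (u - delta) <= t * v + s * delta + eta * delta / 4.
Proof.
have s0 := s_gt0; have t0 := t_gt0; have y0 := y_gt0; have y1 := y_lt.
have p0 := p_gt0; have p1 := p_lt1.
move=> d0 d1 d2.
have yd : 0 < y - delta by lra.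
have E : t * vmean p (u - delta) - (t * v + s * delta) = s * delta ^+ 2 / (y - delta).
  rewrite /v !vmeanE /u; [|lra|lra].
  have -> : p + y - delta - p = y - delta by ring.
  have -> : p + y - p = y by ring.
  have h1 : y - delta != 0 by rewrite gt_eqF.
  have h2 : y != 0 by rewrite gt_eqF.
  have -> : t * (p * (1 - p) / (y - delta) - p) - (t * (p * (1 - p) / y - p) + s * delta) =
    (p * (1 - p) * t) / (y - delta) - (p * (1 - p) * t) / y - s * delta by ring.
  by rewrite yst; field; rewrite h1 h2.
have : s * delta ^+ 2 / (y - delta) <= eta * delta / 4.
  rewrite ler_pdivrMr//.
  have : delta * (8 * s) <= eta * y by rewrite -ler_pdivlMr ?mulr_gt0.
  have eta0 : 0 <= eta.
    rewrite leNgt; apply/negP => h; have : eta * y / (8 * s) < 0.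
      by rewrite pmulr_llt0 ?invr_gt0 ?mulr_gt0// pmulr_llt0.
    by lra.
  move=> h; have k1 : delta * (delta * (8 * s)) <= delta * (eta * y).
    by rewrite ler_pM2l.
  have k2 : delta * eta * y <= delta * eta * (2 * (y - delta)).
    by rewrite ler_wpM2l ?mulr_ge0 ?(ltW d0)//; lra.
  lra.
lra.
Qed.

Lemma vmean_right delta eta : 0 < delta -> delta <= eta * y / (8 * s) ->
  t * vmean p (u + delta) <= t * v - s * delta + eta * delta / 4.
Proof.
have s0 := s_gt0; have t0 := t_gt0; have y0 := y_gt0; have y1 := y_lt.
have p0 := p_gt0; have p1 := p_lt1.
move=> d0 d2; have yd : 0 < y + delta by lra.
have E : t * vmean p (u + delta) - (t * v - s * delta) = s * delta ^+ 2 / (y + delta).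
  rewrite /v !vmeanE /u; [|lra|lra].
  have -> : p + y + delta - p = y + delta by ring.
  have -> : p + y - p = y by ring.
  have h1 : y + delta != 0 by rewrite gt_eqF.
  have h2 : y != 0 by rewrite gt_eqF.
  have -> : t * (p * (1 - p) / (y + delta) - p) - (t * (p * (1 - p) / y - p) - s * delta) =
    (p * (1 - p) * t) / (y + delta) - (p * (1 - p) * t) / y + s * delta by ring.
  by rewrite yst; field; rewrite h1 h2.
have : s * delta ^+ 2 / (y + delta) <= eta * delta / 4.
  rewrite ler_pdivrMr//.
  have : delta * (8 * s) <= eta * y by rewrite -ler_pdivlMr ?mulr_gt0.
  have eta0 : 0 <= eta.
    rewrite leNgt; apply/negP => h; have : eta * y / (8 * s) < 0.
      by rewrite pmulr_llt0 ?invr_gt0 ?mulr_gt0// pmulr_llt0.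
    by lra.
  move=> h; have k1 : delta * (delta * (8 * s)) <= delta * (eta * y).
    by rewrite ler_pM2l.
  have k2 : delta * eta * y <= delta * eta * (2 * (y + delta)).
    by rewrite ler_wpM2l ?mulr_ge0 ?(ltW d0)//; lra.
  lra.
lra.
Qed.

(** If the mean were too small in the characteristic direction, no exit column
could account for the equilibrium total: exits far from the characteristic are
excluded by the upper bound at the densities [u - delta] and [u + delta], the
others by the assumption itself, the mean being Lipschitz. *)
Lemma exit_bound eps delta th N a : 0 < eps -> 0 < delta -> delta <= 1 ->
  delta <= y / 2 -> u + delta < 1 ->
  delta <= (eps / 8) * y / (8 * s) ->
  0 < th -> 4 * th <= delta -> 4 * th * (s + eps / 8) <= (eps / 8) * delta / 4 ->
  meanG p (A N) (n N) < N%:R * (s * u + t * v - eps) ->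
  meanG p a (n N) - a%:R * u + 4 * th * a%:R <=
  N%:R * (t * v - (eps / 8) * delta / 2) +
    (1 + vmean p (u - delta) + vmean p (u + delta)).
Proof.
have s0 := s_gt0; have t0 := t_gt0; have y0 := y_gt0; have y1 := y_lt.
have p0 := p_gt0; have p1 := p_lt1.
move=> eps0 d0 d1 dy ud dd th0 thd ths small.
set eta := eps / 8 in dd ths *.
have eta0 : 0 < eta by rewrite divr_gt0.
have N0 : 0 <= N%:R :> R by [].
have a0 : 0 <= a%:R :> R by [].
have /andP[An1 An2] := truncnP (mulr_ge0 N0 (ltW s_gt0)).
have /andP[nn1 nn2] := truncnP (mulr_ge0 N0 (ltW t_gt0)).
rewrite -/(A N) in An1 An2; rewrite -/(n N) in nn1 nn2.
have yu : u = p + y by [].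
have vl0 : 0 <= vmean p (u - delta) by apply: vmean_ge0; lra.
have vr0 : 0 <= vmean p (u + delta) by apply: vmean_ge0; lra.
have hl := vmean_left d0 dy dd.
have hr := vmean_right d0 dd.
have [al|al] := lerP (N%:R * (s + eta)) a%:R.
  have := mean_upper omega_iid p_gt0 p_lt1 (u := u - delta) _ _ a (n N).
  move=> /(_ ltac:(lra) ltac:(lra)) h.
  have h1 : (n N).+1%:R * vmean p (u - delta) <=
      N%:R * (t * vmean p (u - delta)) + vmean p (u - delta).
    rewrite -natr1 mulrDl mul1r lerD2r mulrA ler_wpM2r//.
  have h2 : N%:R * (s + eta) * (delta - 4 * th) <= a%:R * (delta - 4 * th).
    by rewrite ler_wpM2r// subr_ge0.
  have h3 : N%:R * (t * vmean p (u - delta)) <=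
      N%:R * (t * v + s * delta + eta * delta / 4) by rewrite ler_wpM2l.
  have h4 : N%:R * (4 * th * (s + eta)) <= N%:R * (eta * delta / 4) by rewrite ler_wpM2l.
  lra.
have [ar|ar] := lerP a%:R (N%:R * (s - eta)).
  have := mean_upper omega_iid p_gt0 p_lt1 (u := u + delta) _ _ a (n N).
  move=> /(_ ltac:(lra) ltac:(lra)) h.
  have h1 : (n N).+1%:R * vmean p (u + delta) <=
      N%:R * (t * vmean p (u + delta)) + vmean p (u + delta).
    rewrite -natr1 mulrDl mul1r lerD2r mulrA ler_wpM2r//.
  have h2 : a%:R * (delta + 4 * th) <= N%:R * (s - eta) * (delta + 4 * th).
    by rewrite ler_wpM2r//; lra.
  have h3 : N%:R * (t * vmean p (u + delta)) <=
      N%:R * (t * v - s * delta + eta * delta / 4) by rewrite ler_wpM2l.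
  have h4 : N%:R * (4 * th * (s + eta)) <= N%:R * (eta * delta / 4) by rewrite ler_wpM2l.
  have h5 : 0 <= N%:R * (th * eta) by rewrite !mulr_ge0// ltW.
  lra.
have h1 : meanG p a (n N) <= meanG p (A N) (n N) + N%:R * eta + 1.
  have [aA|aA] := leqP a (A N).
    have := meanG_mono omega_iid p_gt0 p_lt1 aA (leqnn (n N)).
    by have := mulr_ge0 N0 (ltW eta0); lra.
  have := meanG_lip omega_iid p_gt0 p_lt1 (n N) (ltnW aA).
  by rewrite natrB ?(ltnW aA)//; lra.
have h2 : N%:R * (s - eta) * u <= a%:R * u by rewrite ler_wpM2r ?(ltW ar)//; lra.
have h3 : 4 * th * a%:R <= 4 * th * (N%:R * (s + eta)).
  by rewrite ler_wpM2l ?(ltW al)//; lra.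
have h4 : N%:R * (4 * th * (s + eta)) <= N%:R * (eta * delta / 4) by rewrite ler_wpM2l.
have h5 : N%:R * (eta * delta) <= N%:R * eta.
  by rewrite ler_wpM2l// ler_piMr// ltW.
have h6 : N%:R * (eta * u) <= N%:R * eta.
  by rewrite ler_wpM2l// ler_piMr ?(ltW eta0)//; lra.
have h7 : 0 <= N%:R * eta by rewrite mulr_ge0// ltW.
have epsE : eps = 8 * eta by rewrite /eta; field.
rewrite epsE in small; lra.
Qed.

(** Otherwise [exit_bound] applies to all columns, and the sum in
[mean_lower_sum] has linearly many terms, each exponentially smaller than the
left-hand side. *)
Lemma mean_lower eps : 0 < eps -> exists N0, forall N, (N0 <= N)%N ->
  N%:R * (s * u + t * v - eps) <= meanG p (A N) (n N).
Proof.
have s0 := s_gt0; have t0 := t_gt0; have y0 := y_gt0; have y1 := y_lt.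
have p0 := p_gt0; have p1 := p_lt1.
move=> eps0.
pose eta := eps / 8; have eta0 : 0 < eta by rewrite divr_gt0.
pose delta := Num.min (y / 2) (Num.min ((1 - p - y) / 2) (eta * y / (8 * s))).
have d0 : 0 < delta.
  by rewrite !lt_min !divr_gt0 ?mulr_gt0//; lra.
have dy : delta <= y / 2 by rewrite ge_min lexx.
have dq : delta <= (1 - p - y) / 2 by rewrite !ge_min lexx orbT.
have dd : delta <= eta * y / (8 * s) by rewrite !ge_min lexx !orbT.
clearbody delta.
have se0 : 0 < s + eta by rewrite addr_gt0.
pose th := Num.min (2^-1) (Num.min (delta / 8) (eta * delta / (16 * (s + eta)))).
have th0 : 0 < th by rewrite !lt_min invr_gt0 ltr0n !divr_gt0 ?mulr_gt0.
have th2 : th <= 2^-1 by rewrite ge_min lexx.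
have thd : th <= delta / 8 by rewrite !ge_min lexx orbT.
have ths : 4 * th * (s + eta) <= eta * delta / 4.
  have : th <= eta * delta / (16 * (s + eta)) by rewrite !ge_min lexx !orbT.
  by rewrite ler_pdivlMr ?mulr_gt0//; lra.
clearbody th.
have u0 : u = p + y by [].
pose kap := eta * delta / 2; have kap0 : 0 < kap by rewrite divr_gt0 ?mulr_gt0.
pose vl := vmean p (u - delta).
have vl0 : 0 <= vl by apply: vmean_ge0; lra.
pose C := 1 + vl + vmean p (u + delta).
(* a horizon [m] linear in [N] for which the left boundary is negligible *)
pose D := (Num.truncn (2 * ((t + 1) * vl + th^-1) / delta)).+1.
have hD : 2 * ((t + 1) * vl + th^-1) / delta <= D%:R by apply/ltW/truncnS_gt.
pose m N := (D * N.+1)%N.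
have pu : p < u by lra.
have u1 : u < 1 by lra.
have far N : exit_weight p u th (n N) (m N) <= 2^-1.
  have N0 : 0 <= N%:R :> R by [].
  have /andP[nn1 nn2] := truncnP (mulr_ge0 N0 (ltW t_gt0)).
  rewrite -/(n N) in nn1 nn2.
  have := mean_upper omega_iid p_gt0 p_lt1 (u := u - delta) _ _ (m N) (n N).
  move=> /(_ ltac:(lra) ltac:(lra)) h; rewrite -/vl in h.
  have m0 : 0 <= (m N)%:R :> R by [].
  have h1 : (n N).+1%:R * vl <= N%:R * (t * vl) + vl.
    by rewrite -natr1 mulrDl mul1r lerD2r mulrA ler_wpM2r.
  have h2 : (m N)%:R * (4 * th) <= (m N)%:R * (delta / 2).
    by rewrite ler_wpM2l//; lra.
  have h3 : (t + 1) * vl + th^-1 <= D%:R * (delta / 2).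
    by move: hD; rewrite ler_pdivrMr//; lra.
  have h4 : N.+1%:R * ((t + 1) * vl + th^-1) <= N.+1%:R * (D%:R * (delta / 2)).
    by rewrite ler_wpM2l.
  have h5 : N.+1%:R * (D%:R * (delta / 2)) = (m N)%:R * (delta / 2).
    by rewrite natrM mulrCA mulrA.
  rewrite h5 in h4.
  have h6 : meanG p (m N) (n N) - (m N)%:R * u + 4 * th * (m N)%:R <= - th^-1.
    have h7 : 0 <= N%:R * (vl + th^-1) + t * vl.
      have thV : 0 <= th^-1 by rewrite invr_ge0 ltW.
      by apply: addr_ge0; apply: mulr_ge0 => //; [exact: addr_ge0 | exact: ltW].
    have N1 : N.+1%:R = N%:R + 1 :> R by rewrite natr1.
    rewrite N1 in h4; lra.
  have : exit_weight p u th (n N) (m N) <= expR (- 1).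
    rewrite /exit_weight ler_expR.
    have -> : -1 = th * - th^-1 by rewrite mulrN divff// gt_eqF.
    by rewrite ler_pM2l.
  move/le_trans; apply; rewrite expRN lef_pV2 ?posrE ?expR_gt0//.
  exact: expR_ge1Dx.
have kt0 : 0 < kap / (2 * t) by rewrite divr_gt0 ?mulr_gt0.
have [K hK] := exists_buffer p_gt0 p_lt1 pu u1 kt0.
set vK := fmean _ _ in hK.
have vK0 : 0 <= vK.
  apply: fmean_ge0 => //; apply: isdist_geom.
  have u1' : 0 < 1 - u by rewrite subr_gt0.
  have p1' : 0 < 1 - p by rewrite subr_gt0.
  by rewrite divr_gt0 ?mulr_gt0// (lt_trans p0).
have [N0 hN0] := @expR_dominates _ (th * kap / 2) (2 * (D%:R + 1) * expR (th * C) + 1)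
  (divr_gt0 (mulr_gt0 th0 kap0) (ltr0Sn R 1)).
exists N0 => N hN; rewrite leNgt; apply/negP => small.
have Bd a : exit_weight p u th (n N) a <= expR (th * (N%:R * (t * v - kap) + C)).
  rewrite ler_expR ler_pM2l//; apply: exit_bound => //; lra.
have := mean_lower_sum omega_iid p_gt0 p_lt1 pu u1 K (m := m N) (n := n N) (th := th).
rewrite (ltW th0) th2 => /(_ isT).
have far1 : exit_weight p u th (n N) (m N) <= 1 by apply: le_trans (far N) _; lra.
move=> /(_ far1); rewrite -/vK => main.
have N00 : 0 <= N%:R :> R by [].
have /andP[nn1 nn2] := truncnP (mulr_ge0 N00 (ltW t_gt0)).
rewrite -/(n N) in nn1 nn2.
have lo : expR (th * (N%:R * (t * v - kap / 2))) <= expR (th * ((n N).+1%:R * vK)).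
  rewrite ler_expR ler_pM2l//.
  apply: (@le_trans _ _ (N%:R * t * vK)); last first.
    by rewrite ler_wpM2r// -natr1 ltW.
  rewrite -mulrA ler_wpM2l//.
  have : t * (v - kap / (2 * t)) <= t * vK by rewrite ler_pM2l.
  by have -> : t * (v - kap / (2 * t)) = t * v - kap / 2 by field; rewrite gt_eqF.
have up : \sum_(0 <= a < (m N).+1) exit_weight p u th (n N) a <=
    (m N).+1%:R * expR (th * (N%:R * (t * v - kap) + C)).
  apply: (@le_trans _ _ (\sum_(0 <= a < (m N).+1)
    expR (th * (N%:R * (t * v - kap) + C)))); first by apply: ler_sum.
  by rewrite sumr_const_nat subn0 [leRHS]mulr_natl.
have e0 := expR_gt0 (th * ((n N).+1%:R * vK)).
have half : expR (th * ((n N).+1%:R * vK)) / 2 <=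
    expR (th * ((n N).+1%:R * vK)) * (1 - exit_weight p u th (n N) (m N)).
  by rewrite ler_pM2l//; have := far N; lra.
set E := expR (th * (N%:R * (t * v - kap))).
have E0 : 0 < E by exact: expR_gt0.
have EC : expR (th * (N%:R * (t * v - kap) + C)) = E * expR (th * C).
  by rewrite mulrDr expRD.
have EK : expR (th * (N%:R * (t * v - kap / 2))) = E * expR (th * kap / 2 * N%:R).
  by rewrite -expRD; congr expR; field.
have mN : (m N).+1%:R <= (D%:R + 1) * N.+1%:R :> R.
  by rewrite -natr1 natrM mulrDl mul1r lerD2l ler1n.
have := hN0 N hN.
set W := expR (th * kap / 2 * N%:R) => hW.
rewrite EK -/W in lo; rewrite EC in up.
have tot : E * W <= 2 * ((m N).+1%:R * (E * expR (th * C))) by lra.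
have tot2 : W <= 2 * ((m N).+1%:R * expR (th * C)).
  by rewrite -(ler_pM2l E0); apply: le_trans tot _; rewrite le_eqVlt; apply/orP; left; apply/eqP; ring.
have eC0 := expR_gt0 (th * C).
have h : (m N).+1%:R * expR (th * C) <= (D%:R + 1) * N.+1%:R * expR (th * C).
  by rewrite ler_pM2r.
have N1 : 0 < N.+1%:R :> R by rewrite ltr0n.
lra.
Qed.

End Characteristic.
End MeanLimit.

(** * The limit shape *)

Section LimitShape.
Context {R : realType}.
Variables (p s t : R).
Hypotheses (p_gt0 : 0 < p) (p_lt1 : p < 1) (s_gt0 : 0 < s) (t_gt0 : 0 < t).

Let q_gt0 : 0 < 1 - p. Proof. by rewrite subr_gt0. Qed.

(** The critical density [p + y] of [w |-> s * w + t * vmean p w] is below [1]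
exactly for the slopes of the first case of [gpp]. *)
Lemma gpp_characteristic : t < s * ((1 - p) / p) ->
  exists y, [/\ 0 < y, y < 1 - p, p * (1 - p) * t = y ^+ 2 * s &
    gpp p s t = s * (p + y) + t * vmean p (p + y)].
Proof.
move=> tlt.
have pqt0 : 0 < p * (1 - p) * t by rewrite !mulr_gt0.
pose y := Num.sqrt (p * (1 - p) * t / s).
have y0 : 0 < y by rewrite sqrtr_gt0 divr_gt0.
have y2 : y ^+ 2 = p * (1 - p) * t / s by rewrite sqr_sqrtr// ltW// divr_gt0.
exists y; split => //.
- rewrite -(ltr_pXn2r (n := 2)) ?nnegrE ?(ltW q_gt0) ?(ltW y0)// y2.
  rewrite ltr_pdivrMr//.
  have := tlt; rewrite mulrA ltr_pdivlMr// => h.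
  have E : p * (1 - p) * t = (1 - p) * (t * p) by ring.
  by rewrite E expr2 -mulrA ltr_pM2l// [_ * s]mulrC.
- by rewrite y2 divfK// gt_eqF.
rewrite /gpp tlt vmeanE; last by rewrite ltrDl.
have -> : p + y - p = y by ring.
have sy : Num.sqrt (p * s) * Num.sqrt ((1 - p) * t) = s * y.
  rewrite -sqrtrM; last by rewrite mulr_ge0 ?ltW.
  have -> : p * s * ((1 - p) * t) = s ^+ 2 * (p * (1 - p) * t / s).
    by field; rewrite gt_eqF.
  by rewrite sqrtrM ?sqr_ge0// sqrtr_sqr ger0_norm// ltW.
have pqty : t * (p * (1 - p) / y) = s * y.
  have -> : t * (p * (1 - p) / y) = (p * (1 - p) * t / s) * s / y.
    by field; rewrite !gt_eqF.
  by rewrite -y2; field; rewrite gt_eqF.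
rewrite sqrrD !sqr_sqrtr ?mulr_ge0 ?(ltW p_gt0) ?(ltW s_gt0) ?(ltW q_gt0) ?(ltW t_gt0)//.
by rewrite sy mulrBr pqty; ring.
Qed.

Lemma gpp_le : gpp p s t <= s.
Proof.
have [tlt|tge] := ltP t (s * ((1 - p) / p)); last by rewrite /gpp ltNge tge.
have [y [y0 yq yst ->]] := gpp_characteristic tlt.
rewrite vmeanE; last by rewrite ltrDl.
have q0 := q_gt0.
have tE : t = y ^+ 2 * s / (p * (1 - p)).
  by rewrite -yst; field; rewrite !gt_eqF.
have p0 := p_gt0; have h1 : 1 - p != 0 by rewrite gt_eqF.
have -> : s * (p + y) + t * (p * (1 - p) / (p + y - p) - p) =
    s - s * (1 - p - y) ^+ 2 / (1 - p).
  have -> : p + y - p = y by ring.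
  rewrite tE; field; rewrite h1 !gt_eqF//.
by rewrite gerBl divr_ge0 ?(ltW q0)// mulr_ge0 ?sqr_ge0 ?(ltW s_gt0).
Qed.

End LimitShape.

Section MeanAsymptotics.
Context (d : measure_display) (T : measurableType d) (R : realType)
  (P : probability T R) (p : R) (omega : nat * nat -> {RV P >-> bool}).
Hypotheses (omega_iid : iid_bernoulli p omega) (p_gt0 : 0 < p) (p_lt1 : p < 1).

Definition mean_at (s t : R) (N : nat) : R :=
  meanG p (Num.truncn (N%:R * s)) (Num.truncn (N%:R * t)).

Lemma mean_at_le (s t : R) : 0 < s -> 0 < t ->
  exists C, forall N, mean_at s t N <= N%:R * gpp p s t + C.
Proof.
move=> s0 t0.
have sN N : (Num.truncn (N%:R * s))%:R <= N%:R * s :> R.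
  by rewrite truncn_le mulr_ge0// ltW.
have tN N : (Num.truncn (N%:R * t))%:R <= N%:R * t :> R.
  by rewrite truncn_le mulr_ge0// ltW.
have [tlt|tge] := ltP t (s * ((1 - p) / p)); last first.
  exists 0 => N; rewrite /gpp ltNge tge /= addr0.
  by apply: le_trans (sN N); exact: meanG_le.
have [y [y0 yq yst ->]] := gpp_characteristic p_gt0 p_lt1 s0 t0 tlt.
have pu : p < p + y by rewrite ltrDl.
have u1 : p + y < 1 by rewrite -ltrBrDl.
have v0 := vmean_ge0 p_gt0 pu u1.
exists (vmean p (p + y)) => N.
apply: (le_trans (mean_upper omega_iid p_gt0 p_lt1 pu u1 _ _)).
rewrite [N%:R * (_ + _)]mulrDr -addrA; apply: lerD.
  by rewrite mulrA ler_wpM2r ?sN// addr_ge0// ltW.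
by rewrite -natr1 mulrDl mul1r lerD2r mulrA ler_wpM2r.
Qed.

Lemma mean_at_ge (s t eps : R) : 0 < s -> 0 < t -> 0 < eps ->
  exists N0, forall N, (N0 <= N)%N -> N%:R * (gpp p s t - eps) <= mean_at s t N.
Proof.
move=> s0 t0 e0.
have [tlt|tge] := ltP t (s * ((1 - p) / p)).
  have [y [y0 yq yst ->]] := gpp_characteristic p_gt0 p_lt1 s0 t0 tlt.
  exact: (mean_lower omega_iid p_gt0 p_lt1 s0 t0 y0 yq yst e0).
rewrite /gpp ltNge tge /=.
have q0 : 0 < 1 - p by rewrite subr_gt0.
(* just below the critical slope the shape function is already close to [s] *)
pose k := Num.min 2^-1 (eps / (2 * s)).
have k0 : 0 < k by rewrite lt_min invr_gt0 ltr0n divr_gt0// mulr_gt0.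
have k1 : k <= 2^-1 by rewrite ge_min lexx.
have k2 : k * (2 * s) <= eps.
  by rewrite -ler_pdivlMr ?mulr_gt0// ge_min lexx orbT.
clearbody k.
pose y := (1 - k) * (1 - p).
have y0 : 0 < y by rewrite mulr_gt0// subr_gt0; lra.
have yq : y < 1 - p by rewrite /y gtr_pMl//; lra.
pose t' := y ^+ 2 * s / (p * (1 - p)).
have t'0 : 0 < t' by apply: divr_gt0; apply: mulr_gt0 => //; exact: exprn_gt0.
have yst : p * (1 - p) * t' = y ^+ 2 * s.
  by rewrite /t' mulrCA divff ?mulr1// gt_eqF ?mulr_gt0.
have t't : t' <= t.
  apply: le_trans tge; rewrite /t' ler_pdivrMr ?mulr_gt0//.
  have -> : s * ((1 - p) / p) * (p * (1 - p)) = (1 - p) ^+ 2 * s.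
    by field; rewrite gt_eqF.
  by rewrite ler_pM2r// lerXn2r ?nnegrE ?(ltW q0) ?(ltW y0)// ltW.
have [N0 hN0] := mean_lower omega_iid p_gt0 p_lt1 s0 t'0 y0 yq yst (divr_gt0 e0 (ltr0Sn R 1)).
exists N0 => N hN; apply: (@le_trans _ _ (mean_at s t' N)); last first.
  apply: (meanG_mono omega_iid p_gt0 p_lt1) => //.
  by apply: le_truncn; rewrite ler_wpM2l.
apply: le_trans (hN0 N hN); rewrite ler_wpM2l//.
rewrite vmeanE; last by rewrite ltrDl.
have -> : s * (p + y) + t' * (p * (1 - p) / (p + y - p) - p) - eps / 2 =
    s - s * (1 - p) * k ^+ 2 - eps / 2.
  have -> : p + y - p = y by ring.
  rewrite /t' /y; field; rewrite !gt_eqF ?mulr_gt0//; lra.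
have p0 := p_gt0; have : s * (1 - p) * k ^+ 2 <= s * k.
  rewrite -mulrA ler_pM2l// expr2 mulrA ler_piMl ?(ltW k0)//.
  by rewrite mulr_ile1 ?(ltW q0) ?(ltW k0)//; lra.
lra.
Qed.

End MeanAsymptotics.

(** * The lower tail *)

Lemma uniq_flatten_map (I A : eqType) (F : I -> seq A) (r : seq I) : uniq r ->
  (forall i, uniq (F i)) ->
  (forall i j z, z \in F i -> z \in F j -> i = j) -> uniq (flatten (map F r)).
Proof.
move=> ur uF Finj; elim: r ur => //= i r IH /andP[ir ur].
rewrite cat_uniq uF IH// andbT; apply/hasPn => z /flatten_mapP[j jr zj].
by apply: contra ir => zi; rewrite (Finj _ _ _ zi zj).
Qed.

Section LowerTail.
Context (d : measure_display) (T : measurableType d) (R : realType)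
  (P : probability T R) (p : R) (omega : nat * nat -> {RV P >-> bool}).
Hypotheses (omega_iid : iid_bernoulli p omega) (p_gt0 : 0 < p) (p_lt1 : p < 1).

(** Block [b] of corridor [j] has [a] columns and [c.+1] rows. Consecutive blocks
of a corridor share a row but no column, and corridors are shifted by [c.+1] rows,
so that all blocks are disjoint. *)
Definition corner (a c : nat) (jb : nat * nat) : nat * nat :=
  (jb.2 * a, jb.1 * c.+1 + jb.2 * c)%N.

Lemma corner_inj a c jb jb' z : z \in box (corner a c jb) a c ->
  z \in box (corner a c jb') a c -> jb = jb'.
Proof.
case: z => z1 z2; case: jb => j b; case: jb' => j' b'.
rewrite !mem_box /= => /andP[/andP[h1 h2] /andP[h3 h4]] /andP[/andP[h5 h6] /andP[h7 h8]].
have bb : b = b'.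
  have [bb|bb|//] := ltngtP b b'.
    have : (b.+1 * a <= b' * a)%N by rewrite leq_mul2r bb orbT.
    by rewrite mulSn; lia.
  have : (b'.+1 * a <= b * a)%N by rewrite leq_mul2r bb orbT.
  by rewrite mulSn; lia.
rewrite -{}bb in h7 h8 *; congr pair.
have [jj|jj|->//] := ltngtP j j'.
  have : (j.+1 * c.+1 <= j' * c.+1)%N by rewrite leq_mul2r jj orbT.
  by rewrite mulSn; lia.
have : (j'.+1 * c.+1 <= j * c.+1)%N by rewrite leq_mul2r jj orbT.
by rewrite mulSn; lia.
Qed.

Lemma corridor_le eta a c j B :
  (\sum_(b <- iota 0 B) lpp (shift (corner a c (j, b)) eta) a c <=
   lpp eta (B * a) (j * c.+1 + B * c))%N.
Proof.
elim: B => [|B IH]; first by rewrite big_nil.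
rewrite -[in iota _ _](addn1 B) iotaD big_cat big_seq1 add0n.
apply: (@leq_trans (lpp eta (B * a) (j * c.+1 + B * c) +
   lpp (shift (corner a c (j, B)) eta) a c)); first by rewrite leq_add2r.
rewrite !mulSn [(a + _)%N]addnC [(c + _)%N]addnC addnA.
exact: lpp_superadditive.
Qed.

(** The passage time dominates the average over [K] parallel corridors, and the
variance proxy of an average of independent variables is divided by [K]. *)
Lemma corridor_mgf xi a c B K m n : xi < 0 -> - xi <= K%:R / 2 ->
  (B * a <= m)%N -> (K * c.+1 + B * c <= n)%N ->
  Elpp p (fun k => expR (xi * k%:R)) m n <=
  expR (xi * (B%:R * meanG p a c) + 2 * (B * a)%:R * xi ^+ 2 / K%:R).
Proof.
move=> xi0 xiK am cn.
have K0 : 0 < K%:R :> R by lra.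
have Kn0 : K%:R != 0 :> R by rewrite gt_eqF.
pose r := [seq (j, b) | j <- iota 0 K, b <- iota 0 B].
have inr j b : (j, b) \in r -> (j < K)%N /\ (b < B)%N.
  by move=> /allpairsP[[j' b'] /= []]; rewrite !mem_iota => h1 h2 [-> ->].
pose f k := expR (xi / K%:R * k%:R) : R.
have f0 k : 0 <= f k by exact: expR_ge0.
pose F (eta : nat * nat -> bool) := \prod_(i <- r) f (lpp (shift (corner a c i) eta) a c).
have FE eta : F eta = expR (xi / K%:R * \sum_(j <- iota 0 K) \sum_(b <- iota 0 B)
    (lpp (shift (corner a c (j, b)) eta) a c)%:R).
  rewrite /F big_allpairs mulr_sumr expR_sum; apply: eq_bigr => j _.
  by rewrite mulr_sumr expR_sum.
have FElpp : fmean (iid_law (iid_law (bernoulli_law p) n.+1) m) (fun cols => F (colenv cols)) =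
    Elpp p f a c ^+ (K * B).
  apply: EFin_inj; rewrite -(expect_local omega_iid (0, 0)%N (F := F)).
  - have := @expect_boxes _ _ _ _ _ _ omega_iid _ r (corner a c) (fun=> a) (fun=> c)
      (fun=> f) _ (fun _ k => f0 k).
    have -> : (fun x => F (shift (0, 0)%N (env omega x))) =
      (fun x => \prod_(i <- r) f (lpp (shift (corner a c i) (env omega x)) a c)).
      by apply/funext => x; rewrite shift0.
    move=> ->.
      by rewrite big_const_seq count_predT size_allpairs !size_iota iter_mulr_1.
    apply: uniq_flatten_map.
    + by apply: allpairs_uniq; rewrite ?iota_uniq// => -[x1 x2] [y1 y2].
    + by move=> i; exact: uniq_box.
    + exact: corner_inj.
  - by move=> eta; apply: prodr_ge0 => i _.
  - move=> eta eta' e; rewrite /F big_seq [RHS]big_seq.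
    apply: eq_bigr => -[j b] /inr[jK bB]; congr f; apply: eq_lpp => i l /andP[i1 ia] lc.
    rewrite /shift /corner /=.
    have hb : (b.+1 * a <= B * a)%N by rewrite leq_mul2r bB orbT.
    have hb' : (b.+1 * c <= B * c)%N by rewrite leq_mul2r bB orbT.
    have hj : (j.+1 * c.+1 <= K * c.+1)%N by rewrite leq_mul2r jK orbT.
    rewrite !mulSn in hb hb' hj.
    by apply: e; [apply/andP; split|]; lia.
apply: (@le_trans _ _ (Elpp p f a c ^+ (K * B))).
  rewrite -FElpp; apply: ler_fmean; first exact: isdist_cols.
  move=> cols _; rewrite FE ler_expR.
  rewrite -mulrA -subr_ge0 -mulrBr nmulr_rge0// subr_le0.
  rewrite mulrC ler_pdivrMr//.
  apply: (@le_trans _ _ (\sum_(j <- iota 0 K) (lpp (colenv cols) m n)%:R)); last first.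
    by rewrite big_const_seq count_predT size_iota iter_addr_0 mulr_natr.
  rewrite big_seq [leRHS]big_seq; apply: ler_sum => j; rewrite mem_iota => jK.
  rewrite -natr_sum ler_nat; apply: leq_trans (corridor_le _ a c j B) _.
  apply: lpp_mono => //; apply: leq_trans cn; rewrite leq_add2r leq_mul2r; lia.
have Elppf : Elpp p f a c <= expR (xi / K%:R * meanG p a c + 2 * a%:R * (xi / K%:R) ^+ 2).
  apply: Elpp_mgf => //; rewrite normrM normfV (gtr0_norm K0) ltr0_norm//.
  by rewrite ler_pdivrMr//; lra.
apply: (@le_trans _ _ (expR (xi / K%:R * meanG p a c + 2 * a%:R * (xi / K%:R) ^+ 2) ^+ (K * B))).
  by rewrite lerXn2r ?nnegrE ?expR_ge0// Elpp_ge0.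
rewrite -expRM_natl ler_expR !natrM le_eqVlt; apply/orP; left; apply/eqP.
by field.
Qed.


Definition mgf_at (s t xi : R) (N : nat) : R :=
  Elpp p (fun k => expR (xi * k%:R)) (Num.truncn (N%:R * s)) (Num.truncn (N%:R * t)).

(** Jensen's inequality and the upper bound on the mean. *)
Lemma mgf_neg_ge (s t xi : R) : 0 < s -> 0 < t -> xi < 0 ->
  exists C, forall N, expR (N%:R * (xi * gpp p s t) + C) <= mgf_at s t xi N.
Proof.
move=> s0 t0 xi0; have [C hC] := mean_at_le omega_iid p_gt0 p_lt1 s0 t0.
exists (xi * C) => N.
apply: le_trans (jensen_expR (isdist_cols p_gt0 p_lt1 _ _) _ _).
rewrite ler_expR mulrCA -mulrDr ler_nM2l//.
exact: hC.
Qed.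

(** With [K] corridors the correction in [corridor_mgf] is of order [N / K]; with [B]
much larger than [K] the corridors fit into a slightly larger box, and their
blocks still have size proportional to [N], so that the mean is that of the
law of large numbers. *)
Lemma mgf_neg_le (s t xi eps : R) : 0 < s -> 0 < t -> xi < 0 -> 0 < eps ->
  exists N0, forall N, (N0 <= N)%N ->
  mgf_at s t xi N <= expR (N%:R * (xi * gpp p s t + eps)).
Proof.
move=> s0 t0 xi0 e0.
pose ka := - xi; have ka0 : 0 < ka by rewrite oppr_gt0.
(* enough corridors to make the fluctuations negligible *)
pose K := (Num.truncn (2 * ka + 8 * s * xi ^+ 2 / eps)).+1.
have hK : 2 * ka + 8 * s * xi ^+ 2 / eps <= K%:R by apply/ltW/truncnS_gt.
have K8 : 0 <= 8 * s * xi ^+ 2 / eps.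
  by rewrite divr_ge0 ?(ltW e0)// mulr_ge0 ?sqr_ge0// mulr_ge0// ltW.
have K0 : 0 < K%:R :> R by rewrite ltr0n.
have ka_le : ka <= K%:R / 2 by lra.
have K2 : 2 * s * xi ^+ 2 / K%:R <= eps / 4.
  rewrite ler_pdivrMr//.
  have : 8 * s * xi ^+ 2 / eps <= K%:R by lra.
  by rewrite ler_pdivrMr//; lra.
pose de := eps / (8 * ka); have de0 : 0 < de by rewrite divr_gt0 ?mulr_gt0.
have kade : ka * de = eps / 8 by rewrite /de; field; rewrite gt_eqF.
(* enough blocks to make the room for the corridors negligible *)
pose B := (Num.truncn (s * K.+1%:R / de)).+1.
have hB : s * K.+1%:R / de <= B%:R by apply/ltW/truncnS_gt.
have B0 : 0 < B%:R :> R by rewrite ltr0n.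
have [M1 hM1] := mean_at_ge omega_iid p_gt0 p_lt1 s0 t0 de0.
pose M2 := (Num.truncn (K%:R / t)).+1.
pose Q := (B + K.+1)%N.
pose C := ka * (s * Q%:R).
pose N3 := (Num.truncn (4 * C / eps)).+1.
exists (maxn N3 (Q * maxn M1 M2))%N => N; rewrite geq_max => /andP[N3N QN].
pose M := (N %/ Q)%N.
have Q0 : (0 < Q)%N by [].
have MM : (maxn M1 M2 <= M)%N by rewrite leq_divRL// mulnC.
have {MM} [M1M M2M] : (M1 <= M)%N /\ (M2 <= M)%N by move: MM; rewrite geq_max => /andP.
have NQ1 : (Q * M <= N)%N by rewrite mulnC leq_divM.
have NQ2 : (N < Q * M + Q)%N by rewrite {1}(divn_eq N Q) mulnC ltn_add2l ltn_mod.
pose a := Num.truncn (M%:R * s); pose c := Num.truncn (M%:R * t).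
have M0 : 0 <= M%:R :> R by [].
have N0 : 0 <= N%:R :> R by [].
have /andP[a1 a2] := truncnP (mulr_ge0 M0 (ltW s0)); rewrite -/a in a1 a2.
have /andP[c1 c2] := truncnP (mulr_ge0 M0 (ltW t0)); rewrite -/c in c1 c2.
have QNR : B%:R * M%:R + (K%:R + 1) * M%:R <= N%:R :> R.
  by rewrite natr1 -mulrDl -natrD -natrM ler_nat.
have BaN : (B * a)%:R <= N%:R * s :> R.
  rewrite natrM; apply: (@le_trans _ _ (B%:R * (M%:R * s))).
    by rewrite ler_pM2l.
  rewrite mulrA ler_pM2r//; have : 0 <= (K%:R + 1) * M%:R :> R.
    by rewrite mulr_ge0// addr_ge0.
  lra.
have am : (B * a <= Num.truncn (N%:R * s))%N.
  by rewrite truncn_ge_nat// mulr_ge0// ltW.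
have tM : K%:R <= M%:R * t.
  rewrite -ler_pdivrMr//; apply: (@le_trans _ _ M2%:R); first exact/ltW/truncnS_gt.
  by rewrite ler_nat.
have cn : (K * c.+1 + B * c <= Num.truncn (N%:R * t))%N.
  rewrite truncn_ge_nat; last by rewrite mulr_ge0// ltW.
  rewrite natrD !natrM -[c.+1%:R]natr1.
  have h1 : K%:R * c%:R <= K%:R * (M%:R * t) by rewrite ler_pM2l.
  have h2 : B%:R * c%:R <= B%:R * (M%:R * t) by rewrite ler_pM2l.
  have h3 : (B%:R * M%:R + (K%:R + 1) * M%:R) * t <= N%:R * t by rewrite ler_pM2r.
  lra.
apply: (le_trans (corridor_mgf xi0 ka_le am cn)); rewrite ler_expR.
have fluct : 2 * (B * a)%:R * xi ^+ 2 / K%:R <= N%:R * (eps / 4).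
  have -> : 2 * (B * a)%:R * xi ^+ 2 / K%:R = (B * a)%:R * (2 * xi ^+ 2 / K%:R).
    by field; rewrite gt_eqF.
  apply: (@le_trans _ _ (N%:R * s * (2 * xi ^+ 2 / K%:R))).
    by rewrite ler_wpM2r// divr_ge0// mulr_ge0// sqr_ge0.
  have -> : N%:R * s * (2 * xi ^+ 2 / K%:R) = N%:R * (2 * s * xi ^+ 2 / K%:R).
    by field; rewrite gt_eqF.
  by rewrite ler_wpM2l.
set g := gpp p s t.
have gs : g <= s by exact: gpp_le.
have mean_block : N%:R * (g - de) - N%:R * de - s * Q%:R <= B%:R * meanG p a c.
  have e_ge0 : 0 <= B%:R * meanG p a c.
    by rewrite mulr_ge0// Elpp_ge0.
  have sQ : 0 <= s * Q%:R by rewrite mulr_ge0// ltW.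
  have Nde : 0 <= N%:R * de by rewrite mulr_ge0// ltW.
  have [gd|gd] := lerP (g - de) 0.
    by have := mulr_ge0_le0 N0 gd; lra.
  have h1 : B%:R * (M%:R * (g - de)) <= B%:R * meanG p a c.
    by rewrite ler_pM2l//; exact: hM1.
  have h2 : N%:R <= B%:R * M%:R + (K%:R + 1) * M%:R + Q%:R :> R.
    rewrite natr1 -mulrDl -natrD -natrM -natrD ler_nat; exact: ltnW.
  have h3 : (N%:R - B%:R * M%:R) * (g - de) <= (N%:R - B%:R * M%:R) * s.
    apply: ler_wpM2l; last by lra.
    rewrite subr_ge0; have : 0 <= (K%:R + 1) * M%:R :> R by rewrite mulr_ge0// addr_ge0.
    lra.
  have h4 : s * ((K%:R + 1) * M%:R) <= N%:R * de.
    have h5 : s * (K%:R + 1) <= B%:R * de.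
      by move: hB; rewrite ler_pdivrMr// -natr1.
    have h6 : s * (K%:R + 1) * M%:R <= B%:R * de * M%:R by rewrite ler_wpM2r.
    have h7 : B%:R * M%:R * de <= N%:R * de.
      rewrite ler_pM2r//; have : 0 <= (K%:R + 1) * M%:R :> R by rewrite mulr_ge0// addr_ge0.
      lra.
    lra.
  have h8 : (N%:R - B%:R * M%:R) * s <= ((K%:R + 1) * M%:R + Q%:R) * s.
    by rewrite ler_pM2r//; lra.
  lra.
have cst : C <= N%:R * (eps / 4).
  have : 4 * C / eps <= N%:R.
    by apply: (@le_trans _ _ N3%:R); [exact/ltW/truncnS_gt|rewrite ler_nat].
  by rewrite ler_pdivrMr//; lra.
have h : ka * (N%:R * (g - de) - N%:R * de - s * Q%:R) <= ka * (B%:R * meanG p a c).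
  by rewrite ler_pM2l.
have E : ka * (N%:R * (g - de) - N%:R * de - s * Q%:R) =
    ka * (N%:R * g) - 2 * N%:R * (ka * de) - C by rewrite /C; ring.
rewrite E kade in h.
have e1 : xi * (B%:R * meanG p a c) = - (ka * (B%:R * meanG p a c)).
  by rewrite /ka; ring.
have e2 : N%:R * (xi * g + eps) = - (ka * (N%:R * g)) + N%:R * eps.
  by rewrite /ka; ring.
have Ne : 0 <= N%:R * eps by rewrite mulr_ge0// ltW.
rewrite e1 e2; clear - fluct cst h Ne; lra.
Qed.

End LowerTail.

(** * The right tail *)

(** Fekete's lemma. As the limit is an infimum, it also gives a bound without error
term, which makes the estimates uniform over finitely many thresholds. *)
Lemma fekete (R : realType) (a : nat -> R) (N0 : nat) (b : R) : (0 < N0)%N ->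
  (forall N, (N0 <= N)%N -> 0 <= a N <= b * N%:R) ->
  (forall N M, (N0 <= N)%N -> (N0 <= M)%N -> a (N + M)%N <= a N + a M) ->
  exists L, [/\ 0 <= L, forall N, (N0 <= N)%N -> N%:R * L <= a N &
    forall e, 0 < e -> exists N1, forall N, (N1 <= N)%N -> a N <= N%:R * (L + e)].
Proof.
move=> N00 ab asub.
pose S := [set a N / N%:R | N in [set N | (N0 <= N)%N]]%classic.
have pos N : (N0 <= N)%N -> 0 < N%:R :> R.
  by move=> h; rewrite ltr0n (leq_trans N00).
have S0 : (S !=set0)%classic by exists (a N0 / N0%:R), N0 => /=.
have Slb : lbound S 0.
  by move=> _ [N /= hN <-]; have /andP[a0 _] := ab _ hN; rewrite divr_ge0.
have hS : has_inf S by split=> //; exists 0.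
pose L := inf S; exists L.
have L0 : 0 <= L by apply: lb_le_inf.
have LS N : (N0 <= N)%N -> N%:R * L <= a N.
  move=> hN; rewrite mulrC -ler_pdivlMr ?pos//.
  by apply: ge_inf; [exists 0 | exists N].
split=> // e e0.
have [_ [M /= hM <-] aM] := inf_adherent (divr_gt0 e0 (ltr0Sn R 1)) hS.
rewrite -/L in aM.
have b0 : 0 <= b.
  have /andP[h1 h2] := ab _ (leqnn N0).
  by rewrite -(pmulr_lge0 _ (pos _ (leqnn N0))) (le_trans h1).
have M0 := pos _ hM.
have iter k j : (N0 <= j)%N -> a (k * M + j)%N <= k%:R * a M + a j.
  move=> hj; elim: k => [|k IH]; first by rewrite mul0n mul0r add0r.
  rewrite mulSn -addnA; apply: (le_trans (asub _ _ hM _)).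
    by rewrite (leq_trans hj)// leq_addl.
  by rewrite -natr1 mulrDl mul1r; lra.
pose C := b * (N0 + M)%:R.
have C0 : 0 <= C by rewrite mulr_ge0.
exists (maxn N0 (Num.truncn (2 * C / e)).+1) => N; rewrite geq_max => /andP[hN hC].
pose k := ((N - N0) %/ M)%N; pose j := (N - k * M)%N.
have kN : (k * M <= N - N0)%N by exact: leq_divM.
have Mn0 : (0 < M)%N by exact: leq_trans hM.
have kN2 : (N - N0 < k * M + M)%N.
  by rewrite {1}(divn_eq (N - N0) M) ltn_add2l ltn_mod.
have hj : (N0 <= j)%N by rewrite /j; lia.
have hj2 : (j <= N0 + M)%N by rewrite /j; lia.
have NE : N = (k * M + j)%N by rewrite /j; lia.
have := iter k _ hj; rewrite -NE => h1.
have h2 : a j <= C.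
  have /andP[_ h] := ab _ hj; apply: (le_trans h).
  by rewrite ler_wpM2l// ler_nat.
have h3 : k%:R * a M <= k%:R * (M%:R * (L + e / 2)).
  by rewrite ler_wpM2l// mulrC -ler_pdivrMr// ltW.
have h4 : k%:R * M%:R * (L + e / 2) <= N%:R * (L + e / 2).
  rewrite ler_wpM2r ?addr_ge0 ?divr_ge0 ?(ltW e0)// -natrM ler_nat; lia.
have h5 : C <= N%:R * (e / 2).
  have : 2 * C / e <= N%:R.
    by apply: le_trans (ltW (truncnS_gt _)) _; rewrite ler_nat.
  by rewrite ler_pdivrMr//; lra.
lra.
Qed.

Section RightTail.
Context (d : measure_display) (T : measurableType d) (R : realType)
  (P : probability T R) (p : R) (omega : nat * nat -> {RV P >-> bool}).
Hypotheses (omega_iid : iid_bernoulli p omega) (p_gt0 : 0 < p) (p_lt1 : p < 1).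

(** Superadditivity, with the two halves of a concatenated path independent as they
use different columns. *)
Lemma Elpp_super (h1 h2 h : nat -> R) m1 n1 m2 n2 m n :
  (forall k, 0 <= h1 k) -> (forall k, 0 <= h2 k) ->
  (forall i j k, (i + j <= k)%N -> h1 i * h2 j <= h k) ->
  (m1 + m2 <= m)%N -> (n1 + n2 <= n)%N ->
  Elpp p h1 m1 n1 * Elpp p h2 m2 n2 <= Elpp p h m n.
Proof.
move=> h10 h20 hh mm nn.
pose v b := if b then (0, 0)%N else (m1, n1).
pose F (eta : nat * nat -> bool) :=
  h1 (lpp (shift (0, 0)%N eta) m1 n1) * h2 (lpp (shift (m1, n1) eta) m2 n2).
have FE : fmean (iid_law (iid_law (bernoulli_law p) n.+1) m) (fun cols => F (colenv cols)) =
    Elpp p h1 m1 n1 * Elpp p h2 m2 n2.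
  apply: EFin_inj; rewrite -(expect_local omega_iid (0, 0)%N (F := F)).
  - have := @expect_boxes _ _ _ _ _ _ omega_iid _ [:: true; false] v
      (fun b => if b then m1 else m2) (fun b => if b then n1 else n2)
      (fun b => if b then h1 else h2).
    rewrite big_cons big_seq1 /= => <-.
    + by congr expectation; apply/funext => x; rewrite /F big_cons big_seq1 /= !shift0.
    + rewrite cats0 cat_uniq !uniq_box andbT /=.
      apply/hasPn => -[z1 z2] /=; rewrite !mem_box /= => /andP[/andP[hz _] _].
      by apply/negP => /andP[/andP[_ hz'] _]; lia.
    + by case.
  - by move=> eta; exact: mulr_ge0.
  - move=> eta eta' e; rewrite /F; congr (h1 _ * h2 _); apply: eq_lpp => i j /andP[i1 im] jn;
      rewrite /shift /=; apply: e; lia.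
rewrite -FE; apply: ler_fmean; first exact: isdist_cols.
move=> cols _; apply: hh; rewrite shift0.
exact: leq_trans (lpp_superadditive _ _ _ _ _) (lpp_mono _ mm nn).
Qed.

Definition tail (s t r : R) (N : nat) : R :=
  Elpp p (fun k => (N%:R * r <= k%:R)%R%:R) (Num.truncn (N%:R * s)) (Num.truncn (N%:R * t)).

Section Rate.
Variables (s t : R).
Hypotheses (s_gt0 : 0 < s) (t_gt0 : 0 < t).

Lemma tail_le1 r N : tail s t r N <= 1.
Proof.
rewrite -[leRHS](fmean_cst (isdist_cols p_gt0 p_lt1 (Num.truncn (N%:R * s))
  (Num.truncn (N%:R * t)).+1) 1).
apply: ler_fmean; first exact: isdist_cols.
by move=> cols _; rewrite lern1 leq_b1.
Qed.

Lemma tail_anti r r' N : r <= r' -> tail s t r' N <= tail s t r N.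
Proof.
move=> rr'; apply: Elpp_le => // k _; rewrite ler_nat.
case: (boolP (N%:R * r' <= k%:R)) => // h.
by rewrite (le_trans _ h)// ler_wpM2l.
Qed.

(** No rounding error appears, since integer parts are superadditive. *)
Lemma tail_super r1 r2 r N M : (N + M)%:R * r <= N%:R * r1 + M%:R * r2 ->
  tail s t r1 N * tail s t r2 M <= tail s t r (N + M).
Proof.
move=> hr; apply: Elpp_super => //.
- move=> i j k ijk; rewrite -natrM ler_nat mulnb.
  case: (boolP (_ && _)) => // /andP[h1 h2].
  suff -> : (N + M)%:R * r <= k%:R by [].
  apply: (le_trans hr); apply: (@le_trans _ _ (i + j)%:R); last by rewrite ler_nat.
  by rewrite natrD lerD.
- rewrite truncn_ge_nat ?mulr_ge0 ?(ltW s_gt0)// !natrD mulrDl lerD//.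
    by rewrite truncn_le mulr_ge0// ltW.
  by rewrite truncn_le mulr_ge0// ltW.
- rewrite truncn_ge_nat ?mulr_ge0 ?(ltW t_gt0)// !natrD mulrDl lerD//.
    by rewrite truncn_le mulr_ge0// ltW.
  by rewrite truncn_le mulr_ge0// ltW.
Qed.

(** The path along the bottom row sees only ones with probability [p ^+ m], which keeps
the rate finite below [s]. *)
Lemma all_ones m n : p ^+ m <= Elpp p (fun k => (m <= k)%N%:R) m n.
Proof.
elim: m => [|m IH].
  by rewrite expr0 /Elpp fmean_iid0.
apply: (@le_trans _ _ (Elpp p (fun k => (m <= k)%N%:R) m n *
    Elpp p (fun k => (1 <= k)%N%:R) 1 0)); last first.
  apply: Elpp_super => //; rewrite ?addn1 ?addn0// => i j k ijk.
  rewrite -natrM ler_nat mulnb.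
  by case: (boolP (_ && _)) => // /andP[h1 h2]; have -> : (m < k)%N by lia.
have -> : Elpp p (fun k => (1 <= k)%N%:R) 1 0 = p.
  by rewrite /Elpp fmean_iidS fmean_iidS fmean_bernoulli !fmean_iid0 /=; ring.
by rewrite exprSr ler_pM2r.
Qed.

Lemma tail_lb r N : N%:R * r <= (Num.truncn (N%:R * s))%:R ->
  expR (ln p * s * N%:R) <= tail s t r N.
Proof.
move=> h; apply: (@le_trans _ _ (p ^+ (Num.truncn (N%:R * s)))); last first.
  apply: (le_trans (all_ones _ (Num.truncn (N%:R * t)))); apply: Elpp_le => // k _.
  rewrite ler_nat; case: (boolP (Num.truncn (N%:R * s) <= k)%N) => // hk.
  by rewrite (le_trans h)// ler_nat.
rewrite -[p in leRHS]lnK ?posrE// -expRM_natl ler_expR.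
rewrite -mulrA mulrC ler_wnM2r ?ln_le0 ?(ltW p_lt1)//.
by rewrite mulrC truncn_le mulr_ge0// ltW.
Qed.

Lemma tail_reach r N : 1 <= N%:R * (s - r) ->
  N%:R * r <= (Num.truncn (N%:R * s))%:R.
Proof.
move=> h; have /andP[_] := truncnP (mulr_ge0 (ler0n R N) (ltW s_gt0)).
by move: h; rewrite mulrBr; lra.
Qed.

Lemma rate_exists r : r < s -> exists L, [/\ 0 <= L, L <= - ln p * s,
  forall N, 1 <= N%:R * (s - r) -> tail s t r N <= expR (- (N%:R * L)) &
  forall e, 0 < e -> exists N1, forall N, (N1 <= N)%N ->
    expR (- (N%:R * (L + e))) <= tail s t r N].
Proof.
move=> rs; have sr : 0 < s - r by rewrite subr_gt0.
pose b := - ln p * s.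
have ex0 : exists N, 1 <= N%:R * (s - r).
  exists (Num.truncn ((s - r)^-1)).+1.
  by rewrite -ler_pdivrMr// mul1r ltW// truncnS_gt.
pose N0 := ex_minn ex0.
have N0P N : (N0 <= N)%N = (1 <= N%:R * (s - r)).
  rewrite /N0; case: ex_minnP => m hm mmin; apply/idP/idP; last exact: mmin.
  by move=> mN; apply: (le_trans hm); rewrite ler_pM2r// ler_nat.
have N00 : (0 < N0)%N.
  by rewrite lt0n; apply/eqP => h; have := N0P 0; rewrite h leqnn mul0r ler10.
pose a N := - ln (tail s t r N).
have tpos N : (N0 <= N)%N -> 0 < tail s t r N.
  rewrite N0P => /tail_reach/tail_lb; apply: lt_le_trans; exact: expR_gt0.
have tE N : (N0 <= N)%N -> tail s t r N = expR (- a N).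
  by move=> hN; rewrite opprK lnK// posrE tpos.
have ab N : (N0 <= N)%N -> 0 <= a N <= b * N%:R.
  move=> hN; rewrite oppr_ge0 ln_le0 ?tail_le1//=.
  rewrite lerNl -ler_expR lnK ?posrE ?tpos//.
  have := hN; rewrite N0P => /tail_reach/tail_lb; congr (expR _ <= _).
  by rewrite /b; ring.
have asub N M : (N0 <= N)%N -> (N0 <= M)%N -> a (N + M)%N <= a N + a M.
  move=> hN hM; rewrite -lerN2 opprD -ler_expR expRD -!tE//.
    by apply: tail_super; rewrite natrD mulrDl.
  by rewrite (leq_trans hN)// leq_addr.
have [L [L0 LN Le]] := fekete N00 ab asub.
exists L; split => //.
- have := LN _ (leqnn N0); have /andP[_ h] := ab _ (leqnn N0).
  move/le_trans/(_ h); rewrite mulrC ler_pM2r// ltr0n//.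
- by move=> N; rewrite -N0P => hN; rewrite tE// ler_expR lerN2 LN.
move=> e e0; have [N1 hN1] := Le e e0; exists (maxn N0 N1) => N.
rewrite geq_max => /andP[hN hN']; rewrite tE// ler_expR lerN2.
exact: hN1.
Qed.

End Rate.
End RightTail.

(** * Rate functions *)

Lemma cvg_lne (R : realType) (f : nat -> R) (l : R) :
  (forall e, 0 < e -> exists N0, forall N, (N0 <= N)%N ->
    expR (N%:R * (l - e)) <= f N <= expR (N%:R * (l + e))) ->
  ((((N%:R^-1)%:E * lne (f N)%:E) @[N --> \oo])%E --> l%:E)%classic.
Proof.
move=> fl.
have key N e : (0 < N)%N ->
    expR (N%:R * (l - e)) <= f N <= expR (N%:R * (l + e)) ->
    ((N%:R^-1)%:E * lne (f N)%:E)%E = (N%:R^-1 * ln (f N))%:E /\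
    l - e <= N%:R^-1 * ln (f N) <= l + e.
  move=> N0 /andP[h1 h2].
  have f0 : 0 < f N by apply: lt_le_trans h1; exact: expR_gt0.
  have NR : 0 < N%:R :> R by rewrite ltr0n.
  rewrite lne_EFin// -EFinM; split=> //.
  rewrite ler_pdivlMl// ler_pdivrMl//.
  by rewrite -ler_expR -[X in _ && X]ler_expR lnK ?posrE// h1 h2.
apply: cvg_EFin.
  have [N0 hN0] := fl 1 ltr01.
  exists N0.+1 => // N /= hN.
  have [-> _] := key N 1 (leq_trans (ltn0Sn _) hN) (hN0 N (ltnW hN)).
  by [].
apply/cvgrPdist_le => e e0; have [N0 hN0] := fl e e0.
exists N0.+1 => // N /= hN.
have [-> /andP[h1 h2]] := key N e (leq_trans (ltn0Sn _) hN) (hN0 N (ltnW hN)).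
by rewrite /= ler_norml; apply/andP; split; lra.
Qed.

Section RateFunctions.
Context (d : measure_display) (T : measurableType d) (R : realType)
  (P : probability T R) (p : R) (omega : nat * nat -> {RV P >-> bool}).
Hypotheses (omega_iid : iid_bernoulli p omega) (p_gt0 : 0 < p) (p_lt1 : p < 1).
Variables (s t : R).
Hypotheses (s_gt0 : 0 < s) (t_gt0 : 0 < t).

Local Notation g := (gpp p s t).

Lemma GfloorE N x : Gfloor omega s t N x =
  (lpp (env omega x) (Num.truncn (N%:R * s)) (Num.truncn (N%:R * t)))%:R.
Proof. by rewrite /Gfloor /G last_passageE. Qed.

Lemma expect_Gfloor xi N :
  'E_P[fun x : T => expR (xi * Gfloor omega s t N x)]%E = (mgf_at p s t xi N)%:E.
Proof.
rewrite -(expect_lpp omega_iid (0, 0)%N); last by move=> k; exact: expR_ge0.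
by congr expectation; apply/funext => x; rewrite GfloorE shift0.
Qed.

Lemma prob_Gfloor r N :
  P [set x | (N%:R * r <= Gfloor omega s t N x)%R]%classic = (tail p s t r N)%:E.
Proof.
rewrite -(prob_lpp omega_iid (fun k => N%:R * r <= k%:R)).
by congr (P _); apply/seteqP; split => x /=; rewrite GfloorE.
Qed.

Definition Jr (r : R) : R := fine (J_below omega s t r).

Lemma JrP r : r < s -> [/\ J_below omega s t r = (Jr r)%:E, 0 <= Jr r,
  Jr r <= - ln p * s,
  forall N, 1 <= N%:R * (s - r) -> tail p s t r N <= expR (- (N%:R * Jr r)) &
  forall e, 0 < e -> exists N1, forall N, (N1 <= N)%N ->
    expR (- (N%:R * (Jr r + e))) <= tail p s t r N].
Proof.
move=> rs; have [L [L0 Lb LN Le]] := rate_exists omega_iid p_gt0 p_lt1 s_gt0 t_gt0 rs.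
suff JL : J_below omega s t r = L%:E by rewrite /Jr JL.
rewrite /J_below; under eq_fun do rewrite prob_Gfloor.
have : ((((N%:R^-1)%:E * lne (tail p s t r N)%:E) @[N --> \oo])%E --> (- L)%:E)%classic.
  apply: cvg_lne => e e0; have [N1 hN1] := Le e e0.
  exists (maxn N1 (Num.truncn ((s - r)^-1)).+1) => N; rewrite geq_max => /andP[h1 h2].
  have h3 : 1 <= N%:R * (s - r).
    rewrite -ler_pdivrMr ?subr_gt0// mul1r.
    by apply: le_trans (ltW (truncnS_gt _)) _; rewrite ler_nat.
  apply/andP; split.
    by apply: le_trans (hN1 N h1); rewrite ler_expR; lra.
  apply: (le_trans (LN N h3)); rewrite ler_expR -mulrN ler_wpM2l//; lra.
by move/cvg_lim => ->//; rewrite EFinN oppeK.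
Qed.

Lemma Jr_mono r r' : r <= r' -> r' < s -> Jr r <= Jr r'.
Proof.
move=> rr' r's; have rs := le_lt_trans rr' r's.
have [_ _ _ Jle _] := JrP rs; have [_ _ _ _ Jge] := JrP r's.
apply/ler_addgt0Pr => e e0; have [N1 hN1] := Jge e e0.
pose N := (maxn N1 (Num.truncn ((s - r)^-1)).+1).
have hN : 1 <= N%:R * (s - r).
  rewrite -ler_pdivrMr ?subr_gt0// mul1r.
  by apply: le_trans (ltW (truncnS_gt _)) _; rewrite ler_nat leq_maxr.
have N0 : 0 < N%:R :> R by rewrite ltr0n leq_max orbT.
have := le_trans (hN1 N (leq_maxl _ _)) (le_trans
  (tail_anti p_gt0 p_lt1 s t N rr') (Jle N hN)).
by rewrite ler_expR lerN2 ler_pM2l.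
Qed.

Lemma gpp_gt0 : 0 < g.
Proof.
have [tlt|tge] := ltP t (s * ((1 - p) / p)); last by rewrite /gpp [t < _]ltNge tge.
have [y [y0 yq yst ->]] := gpp_characteristic p_gt0 p_lt1 s_gt0 t_gt0 tlt.
have p0 := p_gt0.
rewrite ltr_wpDr ?mulr_gt0 ?addr_gt0// mulr_ge0 ?(ltW t_gt0)//.
by apply: vmean_ge0; lra.
Qed.

Let gs : g <= s. Proof. exact: gpp_le. Qed.

(** As the mean is close to [N * g] and the passage time at most [N * s], the
probability of exceeding [N * r] is bounded away from [0]. *)
Lemma Jr_below r : r < g -> Jr r = 0.
Proof.
move=> rg; have rs := lt_le_trans rg gs.
wlog r0 : r rg rs / 0 <= r.
  move=> wl; have [r0|r0] := leP 0 r; first exact: wl.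
  apply/eqP; rewrite eq_le; have [_ -> _ _ _] := JrP rs; rewrite andbT.
  rewrite -(wl 0) ?gpp_gt0//; apply: Jr_mono => //; exact: ltW.
have [_ J0 _ Jle _] := JrP rs; apply/eqP; rewrite eq_le J0 andbT.
rewrite leNgt; apply/negP => Jpos.
pose e := (g - r) / 2; have e0 : 0 < e by rewrite divr_gt0// subr_gt0.
have [N0 hN0] := mean_at_ge omega_iid p_gt0 p_lt1 s_gt0 t_gt0 e0.
have [N1 hN1] := expR_dominates (s / e + 1) Jpos.
pose N := maxn (maxn N0 N1) (Num.truncn ((s - r)^-1)).+1.
have NN0 : (N0 <= N)%N by rewrite !leq_max leqnn.
have NN1 : (N1 <= N)%N by rewrite !leq_max leqnn orbT.
have hN : 1 <= N%:R * (s - r).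
  rewrite -ler_pdivrMr ?subr_gt0// mul1r.
  by apply: le_trans (ltW (truncnS_gt _)) _; rewrite ler_nat leq_maxr.
have N0R : 0 < N%:R :> R by rewrite ltr0n leq_max orbT.
have mean_le : mean_at p s t N <= N%:R * r + N%:R * s * tail p s t r N.
  have dc := isdist_cols p_gt0 p_lt1 (Num.truncn (N%:R * s))
    (Num.truncn (N%:R * t)).+1.
  rewrite /mean_at /meanG /tail /Elpp -fmeanZ -[X in _ <= X + _](fmean_cst dc) -fmeanD.
  apply: ler_fmean; first exact: isdist_cols.
  move=> cols _; set k := lpp _ _ _.
  have kN : k%:R <= N%:R * s.
    apply: (@le_trans _ _ (Num.truncn (N%:R * s))%:R).
      by rewrite ler_nat lpp_le.
    by rewrite truncn_le mulr_ge0// ltW.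
  have Nr : 0 <= N%:R * r by rewrite mulr_ge0.
  by case: (lerP (N%:R * r) k%:R) => h /=; rewrite ?mulr1n ?mulr0n ?mulr1 ?mulr0; lra.
have := hN0 N NN0.
have -> : g - e = r + e by rewrite /e; field.
move=> /le_trans/(_ mean_le) h1.
have h2 : e <= s * tail p s t r N by rewrite -(ler_pM2l N0R); lra.
have h3 : e <= s * expR (- (N%:R * Jr r)).
  by apply: (le_trans h2); rewrite ler_pM2l// Jle.
have := hN1 N NN1; rewrite expRN [Jr r * _]mulrC in h3 *.
have E0 := expR_gt0 (N%:R * Jr r); set E := expR _ in h3 E0 *.
rewrite ler_pdivlMr// in h3.
move=> h4; have h5 : s / e + 1 <= E.
  apply: le_trans h4; have se : 0 <= s / e by rewrite divr_ge0// ltW.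
  by rewrite ler_peMr ?ler1n// addr_ge0.
have : e * (s / e + 1) <= e * E by rewrite ler_pM2l.
by rewrite mulrDr mulr1 mulrCA divff ?gt_eqF// mulr1; lra.
Qed.

(** A short stretch with slope [r2 > g] compensates a long one with slope [r1 < g]
that costs nothing, so that [Jr g <= Jr r2 / M] for every [M]. *)
Lemma Jr_gpp : g < s -> Jr g = 0.
Proof.
move=> gs'; pose r2 := (g + s) / 2.
have gr2 : g < r2 by rewrite /r2; lra.
have r2s : r2 < s by rewrite /r2; lra.
have [_ J0 _ Jle _] := JrP gs'.
have [_ J20 _ _ J2ge] := JrP r2s.
have main (M : nat) : M.+1%:R * Jr g <= Jr r2.
  pose r1 := g - (r2 - g) / M.+1%:R.
  have M0 : 0 < M.+1%:R :> R by rewrite ltr0n.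
  have r1g : r1 < g by rewrite /r1 ltrBlDr ltrDl divr_gt0// subr_gt0.
  have r1s := lt_trans r1g gs'.
  have [_ _ _ _ J1ge] := JrP r1s; rewrite (Jr_below r1g) in J1ge.
  apply/ler_addgt0Pr => e e0.
  have de0 : 0 < e / (M.+1%:R + 1) by rewrite divr_gt0// addr_gt0.
  have [N1 hN1] := J1ge _ de0; have [N2 hN2] := J2ge _ de0.
  pose k := maxn (maxn N1 N2) (Num.truncn ((s - g)^-1)).+1.
  have k1 : (N1 <= k)%N by rewrite !leq_max leqnn.
  have k2 : (N2 <= k)%N by rewrite !leq_max leqnn orbT.
  have k0 : 0 < k%:R :> R by rewrite ltr0n leq_max orbT.
  have h1 := hN1 (M.+1 * k)%N (leq_trans k1 (leq_pmull _ (ltn0Sn M))).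
  have h2 := hN2 k k2.
  have sup : (M.+1 * k + k)%:R * g <= (M.+1 * k)%:R * r1 + k%:R * r2.
    rewrite natrD natrM /r1 le_eqVlt; apply/orP; left; apply/eqP.
    by field; rewrite gt_eqF.
  have h3 := tail_super omega_iid p_gt0 p_lt1 s_gt0 t_gt0 sup.
  have hN : 1 <= (M.+1 * k + k)%:R * (s - g).
    rewrite -ler_pdivrMr ?subr_gt0// mul1r.
    apply: le_trans (ltW (truncnS_gt _)) _; rewrite ler_nat.
    by apply: (@leq_trans k); rewrite ?leq_maxr// leq_addl.
  have h4 := Jle _ hN.
  have := le_trans (ler_pM (expR_ge0 _) (expR_ge0 _) h1 h2) (le_trans h3 h4).
  rewrite -expRD ler_expR natrD natrM add0r.
  set q := e / _ in de0 *; have qE : q * (M.+1%:R + 1) = e.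
    by rewrite /q divfK// gt_eqF// addr_gt0.
  move=> h5; rewrite -(ler_pM2l k0) -qE.
  have := mulr_ge0 (ltW k0) J0; lra.
apply/eqP; rewrite eq_le J0 andbT leNgt; apply/negP => Jpos.
have := main (Num.truncn (Jr r2 / Jr g)).
have := truncnS_gt (Jr r2 / Jr g); rewrite ltr_pdivrMr//; lra.
Qed.

Lemma rate_J_below r : r < s -> rate_J omega s t r = (Jr r)%:E.
Proof. by move=> rs; rewrite /rate_J rs; have [-> _ _ _ _] := JrP rs. Qed.

(** At [s] the rate is a limit of a nondecreasing bounded function. *)
Lemma rate_J_s : exists2 Ls, rate_J omega s t s = Ls%:E &
  (forall r, r < s -> Jr r <= Ls) /\ (g = s -> Ls = 0).
Proof.
have cv : cvg (Jr r @[r --> s^'-])%classic.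
  apply: nondecreasing_at_left_is_cvgr.
    apply: nearW => x r r'; rewrite !in_itv /= => /andP[_ rs] /andP[_ r's] rr'.
    exact: Jr_mono.
  apply: nearW => x; exists (- ln p * s) => z [r /=]; rewrite in_itv /= => /andP[_ rs] <-.
  by have [_ _ h _ _] := JrP rs.
pose Ls := lim (Jr r @[r --> s^'-])%classic; exists Ls.
  rewrite /rate_J ltxx eqxx; apply: cvg_lim => //.
  apply: (@cvg_trans _ ((Jr r)%:E @[r --> s^'-])%classic).
    apply: near_eq_cvg; near=> r.
    have rs : r < s by near: r; exact: nbhs_left_lt.
    by have [-> _ _ _ _] := JrP rs.
  exact: cvg_comp cv _.
split=> [r rs|gE].
  apply: limr_ge => //; near=> r'; apply: Jr_mono; near: r'.
    exact: nbhs_left_ge.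
  exact: nbhs_left_lt.
apply: cvg_lim => //; apply: (@cvg_trans _ ((0 : R) @[r --> s^'-])%classic).
  apply: near_eq_cvg; near=> r.
  by rewrite Jr_below// gE; near: r; exact: nbhs_left_lt.
exact: cvg_cst.
Unshelve. all: by end_near.
Qed.

Lemma rate_J_gpp : rate_J omega s t g = 0%E.
Proof.
have [gs'|sg] := ltP g s; first by rewrite rate_J_below// Jr_gpp.
have gE : g = s by apply/eqP; rewrite eq_le gs sg.
by have [Ls + [_ /(_ gE) LE]] := rate_J_s; rewrite gE => ->; rewrite LE.
Qed.

Lemma rate_J_ge0 r : (0 <= rate_J omega s t r)%E.
Proof.
have [rs|rs|->] := ltgtP r s.
- by rewrite rate_J_below// lee_fin; have [] := JrP rs.
- by rewrite /rate_J ltNge (ltW rs)/= gt_eqF.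
have [Ls -> [h _]] := rate_J_s; rewrite lee_fin.
have h0 : s - 1 < s by lra.
by apply: le_trans (h _ h0); have [] := JrP h0.
Qed.

End RateFunctions.

(** * Legendre duals *)

Section Dual.
Context (d : measure_display) (T : measurableType d) (R : realType)
  (P : probability T R) (p : R) (omega : nat * nat -> {RV P >-> bool}).
Hypotheses (omega_iid : iid_bernoulli p omega) (p_gt0 : 0 < p) (p_lt1 : p < 1).
Variables (s t : R).
Hypotheses (s_gt0 : 0 < s) (t_gt0 : 0 < t).

Local Notation g := (gpp p s t).
Local Notation Jr := (Jr omega s t).

Let gs : g <= s. Proof. exact: gpp_le. Qed.

Lemma legendre_ge (f : R -> \bar R) xi r : ((xi * r)%:E - f r <= legendre f xi)%E.
Proof. by apply: ereal_sup_ubound; exists r. Qed.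

Lemma legendre_le (f : R -> \bar R) xi b :
  (forall r, ((xi * r)%:E - f r <= b)%E) -> (legendre f xi <= b)%E.
Proof. by move=> h; apply: ge_ereal_sup => _ [r _ <-]. Qed.

Lemma legendre_rate_I_ge_gpp xi :
  ((xi * g)%:E <= legendre (rate_I omega p s t) xi)%E.
Proof.
have := legendre_ge (rate_I omega p s t) xi g.
by rewrite /rate_I lexx gs /= (rate_J_gpp omega_iid)// sube0.
Qed.

Lemma legendre_rate_I_le0 xi : xi <= 0 ->
  legendre (rate_I omega p s t) xi = (xi * g)%:E.
Proof.
move=> xi0; apply/eqP; rewrite eq_le legendre_rate_I_ge_gpp andbT.
apply: legendre_le => r; rewrite /rate_I; case: ifPn => [/andP[gr _]|_].
  apply: (@le_trans _ _ (xi * r)%:E).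
    have := rate_J_ge0 omega_iid p_gt0 p_lt1 s_gt0 t_gt0 r.
    case: (rate_J _ _ _ _) => [x| |] //; last by rewrite leNye.
    by rewrite -EFinB !lee_fin gerBl.
  by rewrite lee_fin ler_wnM2l.
by rewrite /= leNye.
Qed.

(** For [xi > 0] both duals equal the supremum over [r < s]: the point [s] is a
limit of such [r], and [r < g] gives less than [r = g], where the rate vanishes. *)
Section Positive.
Variable xi : R.
Hypothesis xi_gt0 : 0 < xi.

Let S := [set xi * r - Jr r | r in [set r | r < s]]%classic.
Let l := sup S.

Let S_sup : has_sup S.
Proof.
split; first by exists (xi * (s - 1) - Jr (s - 1)), (s - 1) => //=; lra.
exists (xi * s) => _ [r /= rs <-].
have [_ J0 _ _ _] := JrP omega_iid p_gt0 p_lt1 s_gt0 t_gt0 rs.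
by have : xi * r <= xi * s; [rewrite ler_pM2l// ltW | lra].
Qed.

Let l_ge r : r < s -> xi * r - Jr r <= l.
Proof. by move=> rs; apply: ub_le_sup; [case: S_sup | exists r]. Qed.

Let legendre_J_le : (legendre (rate_J omega s t) xi <= l%:E)%E.
Proof.
apply: legendre_le => r; have [rs|rs|->] := ltgtP r s.
- by rewrite (rate_J_below omega_iid)// -EFinB lee_fin l_ge.
- by rewrite /rate_J ltNge (ltW rs)/= gt_eqF//= leNye.
have [Ls -> [h _]] := rate_J_s omega_iid p_gt0 p_lt1 s_gt0 t_gt0.
rewrite -EFinB lee_fin; apply/ler_addgt0Pr => e e0.
pose r' := s - e / xi.
have r's : r' < s by rewrite /r' ltrBlDr ltrDl divr_gt0.
have := l_ge r's; have := h _ r's.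
have -> : xi * r' = xi * s - e by rewrite /r'; field; rewrite gt_eqF.
lra.
Qed.

Let legendre_I_le : (legendre (rate_I omega p s t) xi <= legendre (rate_J omega s t) xi)%E.
Proof.
apply: legendre_le => r; rewrite /rate_I; case: ifPn => _; first exact: legendre_ge.
by rewrite /= leNye.
Qed.

Let legendre_I_ge : (l%:E <= legendre (rate_I omega p s t) xi)%E.
Proof.
have fin : legendre (rate_I omega p s t) xi \is a fin_num.
  rewrite fin_numElt (lt_le_trans _ (legendre_rate_I_ge_gpp _)) ?ltNyr//=.
  by rewrite (le_lt_trans (le_trans legendre_I_le legendre_J_le)) ?ltry.
rewrite -(fineK fin) lee_fin; apply: ge_sup; first by case: S_sup.
move=> _ [r /= rs <-]; rewrite -lee_fin fineK//.
have [gr|rg] := leP g r.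
  have := legendre_ge (rate_I omega p s t) xi r.
  by rewrite /rate_I gr (ltW rs)/= (rate_J_below omega_iid)// EFinB.
rewrite (Jr_below omega_iid)// subr0.
apply: le_trans (legendre_rate_I_ge_gpp _).
by rewrite lee_fin ler_pM2l// ltW.
Qed.

Lemma legendre_rate_J_gt0 : legendre (rate_J omega s t) xi = l%:E.
Proof.
apply/eqP; rewrite eq_le legendre_J_le /=.
exact: le_trans legendre_I_ge legendre_I_le.
Qed.

Lemma legendre_rate_I_gt0 : legendre (rate_I omega p s t) xi = l%:E.
Proof.
apply/eqP; rewrite eq_le legendre_I_ge andbT.
exact: le_trans legendre_I_le legendre_J_le.
Qed.

Lemma mgf_pos_ge e : 0 < e -> exists N0, forall N, (N0 <= N)%N ->
  expR (N%:R * (l - e)) <= mgf_at p s t xi N.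
Proof.
move=> e0; have [_ [r /= rs <-] hr] := sup_adherent (divr_gt0 e0 (ltr0Sn R 1)) S_sup.
rewrite -/l in hr.
have [_ _ _ _ Jge] := JrP omega_iid p_gt0 p_lt1 s_gt0 t_gt0 rs.
have [N1 hN1] := Jge _ (divr_gt0 e0 (ltr0Sn R 1)); exists N1 => N /hN1 h.
apply: (@le_trans _ _ (expR (xi * (N%:R * r)) * tail p s t r N)).
  apply: (@le_trans _ _ (expR (xi * (N%:R * r)) * expR (- (N%:R * (Jr r + e / 2))))).
    rewrite -expRD ler_expR.
    have -> : xi * (N%:R * r) - N%:R * (Jr r + e / 2) =
      N%:R * (xi * r - Jr r - e / 2) by ring.
    by rewrite ler_wpM2l//; lra.
  by rewrite ler_pM2l ?expR_gt0.
rewrite /mgf_at /tail /Elpp -fmeanZ; apply: ler_fmean; first exact: isdist_cols.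
move=> cols _; set k := lpp _ _ _.
case: (boolP (N%:R * r <= k%:R)) => h' /=; last by rewrite mulr0 expR_ge0.
by rewrite mulr1 ler_expR ler_pM2l.
Qed.

(** Laplace's method: cut the range of the passage time into [m.+1] equal pieces and
bound the exponential on each by its value at the right end. *)
Lemma mgf_pos_le_pieces (m N : nat) : (m.+1%:R <= N%:R * s) ->
  mgf_at p s t xi N <= m.+1%:R * expR (N%:R * (l + xi * s / m.+1%:R)).
Proof.
move=> mN; have m0 : 0 < m.+1%:R :> R by rewrite ltr0n.
pose r (i : nat) : R := i%:R * s / m.+1%:R.
have N0 : 0 < N%:R :> R by rewrite -(pmulr_lgt0 _ s_gt0) (lt_le_trans _ mN).
have piece i : (i < m.+1)%N -> expR (xi * (N%:R * r i.+1)) * tail p s t (r i) N <=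
    expR (N%:R * (l + xi * s / m.+1%:R)).
  move=> im; have ris : r i < s.
    by rewrite /r ltr_pdivrMr// mulrC ltr_pM2l// ltr_nat.
  have [_ _ _ Jle _] := JrP omega_iid p_gt0 p_lt1 s_gt0 t_gt0 ris.
  have hN : 1 <= N%:R * (s - r i).
    have -> : N%:R * (s - r i) = N%:R * s * (m.+1%:R - i%:R) / m.+1%:R.
      by rewrite /r; field; rewrite gt_eqF.
    rewrite ler_pdivlMr// mul1r; apply: (le_trans mN).
    rewrite ler_peMr ?mulr_ge0 ?(ltW s_gt0)//.
    by rewrite lerBrDr addrC natr1 ler_nat.
  apply: (le_trans (ler_wpM2l (expR_ge0 _) (Jle N hN))).
  rewrite -expRD ler_expR.
  have -> : xi * (N%:R * r i.+1) - N%:R * Jr (r i) =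
      N%:R * (xi * r i - Jr (r i) + xi * s / m.+1%:R).
    by rewrite /r -natr1; field; rewrite gt_eqF.
  by rewrite ler_pM2l// lerD2r l_ge.
apply: (@le_trans _ _ (\sum_(0 <= i < m.+1)
    expR (xi * (N%:R * r i.+1)) * tail p s t (r i) N)); last first.
  apply: (@le_trans _ _ (\sum_(0 <= i < m.+1)
      expR (N%:R * (l + xi * s / m.+1%:R)))).
    by apply: ler_sum_nat => i /andP[_ im]; exact: piece.
  by rewrite sumr_const_nat subn0 [leRHS]mulr_natl.
rewrite /mgf_at /tail /Elpp.
under eq_bigr do rewrite -fmeanZ.
rewrite -fmean_sum; apply: ler_fmean; first exact: isdist_cols.
move=> cols _; set k := lpp _ _ _.
have kN : k%:R <= N%:R * s.
  apply: (@le_trans _ _ (Num.truncn (N%:R * s))%:R); first by rewrite ler_nat lpp_le.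
  by rewrite truncn_le mulr_ge0// ltW.
pose i := minn m (Num.truncn (k%:R * m.+1%:R / (N%:R * s))).
have q0 : 0 <= k%:R * m.+1%:R / (N%:R * s).
  by rewrite divr_ge0 ?mulr_ge0// ltW.
have /andP[q1 q2] := truncnP q0.
have Ns0 : 0 < N%:R * s by rewrite mulr_gt0.
have ri : N%:R * r i <= k%:R.
  have : i%:R <= k%:R * m.+1%:R / (N%:R * s).
    by apply: le_trans q1; rewrite ler_nat geq_minr.
  rewrite ler_pdivlMr// => h.
  have -> : N%:R * r i = i%:R * (N%:R * s) / m.+1%:R by rewrite /r; ring.
  by rewrite ler_pdivrMr.
have ri1 : k%:R <= N%:R * r i.+1.
  have -> : N%:R * r i.+1 = i.+1%:R * (N%:R * s) / m.+1%:R by rewrite /r; ring.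
  rewrite ler_pdivlMr// /i.
  case: (leqP m (Num.truncn (k%:R * m.+1%:R / (N%:R * s)))) => [mq|qm].
    by rewrite mulrC ler_pM2l.
  by move: q2; rewrite ltr_pdivrMr// natr1; exact: ltW.
rewrite (bigD1_seq i) ?iota_uniq//=; last by rewrite mem_index_iota ltnS geq_minl.
apply: ler_wpDr; first by apply: sumr_ge0 => j _; rewrite mulr_ge0 ?expR_ge0.
by rewrite ri mulr1 ler_expR ler_pM2l.
Qed.

Lemma mgf_pos_le e : 0 < e -> exists N0, forall N, (N0 <= N)%N ->
  mgf_at p s t xi N <= expR (N%:R * (l + e)).
Proof.
move=> e0.
pose m := Num.truncn (2 * (xi * s) / e).
have hm : xi * s / m.+1%:R <= e / 2.
  rewrite ler_pdivrMr ?ltr0n//.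
  have := ltW (truncnS_gt (2 * (xi * s) / e)); rewrite -/m ler_pdivrMr//; lra.
have [N1 hN1] := expR_dominates m.+1%:R (divr_gt0 e0 (ltr0Sn R 1)).
exists (maxn N1 (Num.truncn (m.+1%:R / s)).+1) => N; rewrite geq_max => /andP[h1 h2].
have mN : m.+1%:R <= N%:R * s.
  rewrite -ler_pdivrMr//; apply: le_trans (ltW (truncnS_gt _)) _.
  by rewrite ler_nat.
apply: (le_trans (mgf_pos_le_pieces mN)).
have h3 : m.+1%:R <= expR (e / 2 * N%:R).
  by apply: le_trans (hN1 N h1); rewrite ler_peMr// ler1n.
apply: (@le_trans _ _ (expR (e / 2 * N%:R) * expR (N%:R * (l + e / 2)))).
  by apply: ler_pM; rewrite ?expR_ge0// ler_expR ler_wpM2l// lerD2l.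
by rewrite -expRD ler_expR; lra.
Qed.

End Positive.
End Dual.

Local Open Scope classical_set_scope.

Theorem corollary3p6 (d : measure_display) (T : measurableType d)
    (R : realType) (P : probability T R) (p : R)
    (omega : nat * nat -> {RV P >-> bool})
    (p_gt0 : 0 < p) (p_lt1 : p < 1) (omega_iid : iid_bernoulli p omega)
    (s t : R) (s_gt0 : 0 < s) (t_gt0 : 0 < t) (xi : R) :
  ((N%:R^-1)%:E * lne 'E_P[fun x : T => expR (xi * Gfloor omega s t N x)]
     @[N --> \oo] --> legendre (rate_I omega p s t) xi)%E /\
  legendre (rate_I omega p s t) xi =
    if xi > 0 then legendre (rate_J omega s t) xi
    else if xi == 0 then 0%E
    else (xi * gpp p s t)%:E.
Proof.
have g_le := gpp_le p_gt0 p_lt1 s_gt0 t_gt0.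
have le0 : xi <= 0 -> legendre (rate_I omega p s t) xi = (xi * gpp p s t)%:E.
  exact: legendre_rate_I_le0.
split; last first.
  have [xi0|xi0|xi0] := ltgtP xi 0.
  - by rewrite le0// ltW.
  - by rewrite (legendre_rate_I_gt0 omega_iid)// (legendre_rate_J_gt0 omega_iid).
  - by rewrite le0 ?xi0// mul0r.
under eq_fun do rewrite (expect_Gfloor omega_iid).
have [xi0|xi0|xi0] := ltgtP xi 0.
- rewrite le0 ?(ltW xi0)//; apply: cvg_lne => e e0.
  have [C hC] := mgf_neg_ge omega_iid p_gt0 p_lt1 s_gt0 t_gt0 xi0.
  have [N1 hN1] := mgf_neg_le omega_iid p_gt0 p_lt1 s_gt0 t_gt0 xi0 e0.
  exists (maxn N1 (Num.truncn (- C / e)).+1) => N; rewrite geq_max => /andP[h1 h2].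
  rewrite hN1// andbT; apply: le_trans (hC N); rewrite ler_expR.
  have : - C / e <= N%:R.
    by apply: le_trans (ltW (truncnS_gt _)) _; rewrite ler_nat.
  by rewrite ler_pdivrMr//; lra.
- rewrite (legendre_rate_I_gt0 omega_iid)//; apply: cvg_lne => e e0.
  have [N1 hN1] := mgf_pos_ge omega_iid p_gt0 p_lt1 s_gt0 t_gt0 xi0 e0.
  have [N2 hN2] := mgf_pos_le omega_iid p_gt0 p_lt1 s_gt0 t_gt0 xi0 e0.
  exists (maxn N1 N2) => N; rewrite geq_max => /andP[h1 h2].
  by rewrite hN1// hN2.
- rewrite le0 ?xi0// mul0r; apply: cvg_lne => e e0; exists 0%N => N _.
  have -> : mgf_at p s t 0 N = expR 0.
    rewrite expR0 /mgf_at /Elpp -[RHS](fmean_cst (isdist_cols p_gt0 p_lt1 (Num.truncn (N%:R * s))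
      (Num.truncn (N%:R * t)).+1)).
    by apply: eq_fmean => cols _; rewrite mul0r expR0.
  have Ne : 0 <= N%:R * e by rewrite mulr_ge0// ltW.
  by rewrite !ler_expR; apply/andP; split; lra.
Qed.
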